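(* Let $a,b\ge 2$ be integers and set $$\ell=b+2,\qquad m=2a+1,\qquad n=ab+b+1,$$ and assume $\gcd(\ell,m)=1$. Let $p>m$ and $q>n$ be integers and let $C$ be the irreducible curve germ defined by $$\mathcal{O}_C=\mathbb{K}\{t^\ell,\;t^m+t^p,\;t^n+t^q\}\subset\mathbb{K}\{t\}.$$ Let $\gamma$ be the conductor of the semigroup $\Gamma=\langle \ell,m,n\rangle$ and set $$d_1=(a+1)(b+2),\qquad \delta=\min\{p-m,\;q-n\}.$$ Then: (a) If $d_1+\delta\ge\gamma$, then $\Gamma$ is the value semigroup of $C$. (b) If $d_1+\delta\ge\gamma+\ell$, then $C$ is a set-theoretic complete intersection. (c) If $a,b\ge 3$ and $d_1+q-n\ge\gamma+\ell$, then $\gamma-1-\ell>m$, and the curve germ $C$ defined by taking $p:=\gamma-1-\ell$ is a non-monomial set-theoretic complete intersection.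
   Context: $\mathbb{K}$ is an algebraically closed field that is complete with respect to a non-discrete (i.e. non-trivial) absolute value; $\mathbb{K}\{\cdot\}$ denotes convergent power series, and for elements $\xi_1,\dots,\xi_r$ of the maximal ideal of $\mathbb{K}\{t\}$, $\mathbb{K}\{\xi_1,\dots,\xi_r\}\subset\mathbb{K}\{t\}$ denotes the $\mathbb{K}$-analytic subalgebra they generate, i.e. the image of $\mathbb{K}\{x_1,\dots,x_r\}\to\mathbb{K}\{t\}$, $x_i\mapsto\xi_i$. $\mathbb{N}=\{0,1,2,\dots\}$. $\Gamma=\langle\ell,m,n\rangle\subset\mathbb{N}$ is the additive submonoid generated by $\ell,m,n$; its conductor is the least $\gamma\in\mathbb{N}$ with $\gamma+\mathbb{N}\subset\Gamma$. The value semigroup of $C$ is $\{\operatorname{ord}_t(h)\mid 0\ne h\in\mathcal{O}_C\}$. $C$ is regarded as a space curve germ via the presentation $\mathbb{K}\{x,y,z\}\to\mathcal{O}_C$ sending $x,y,z$ to the three given generators. An ideal $I$ of $\mathbb{K}\{x,y,z\}$ (and the germ it defines) is a set-theoretic complete intersection if $\sqrt{I}=\sqrt{I'}$ for some ideal $I'$ generated by $\operatorname{height} I$ many elements; for $C$ this means that the prime ideal of $C$ is the radical of an ideal generated by two elements. ''Non-monomial'' means that $C$ is not isomorphic to the monomial curve germ with ring $\mathbb{K}\{t^\ell,t^m,t^n\}$.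
   Formalization: In (c), ''non-monomial'' is proved only when the characteristic of K does not divide ℓ; otherwise it can fail, e.g. char K = 5, a = b = 3, q = 15, p = 11, where t ↦ t+2t^5 shows C is monomial. *)

(* Defs.v *)
(* MathComp, with the type of real numbers and the classical layer of
   MathComp-Analysis, and the multi-indices of multinomials.                  *)
From HB Require Import structures.
From mathcomp Require Import all_boot all_order all_algebra.
From mathcomp Require Import boolp classical_sets functions reals.
From mathcomp Require Import mpoly.

Set Implicit Arguments.
Unset Strict Implicit.
Unset Printing Implicit Defensive.

Import Order.TTheory GRing.Theory Num.Theory.

Local Open Scope ring_scope.
Local Open Scope classical_set_scope.

Record fps (r : nat) (K : Type) := Fps { fps_coef :> 'X_{1..r} -> K }.

HB.instance Definition _ r K := gen_eqMixin (fps r K).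
HB.instance Definition _ r K := gen_choiceMixin (fps r K).

Lemma fpsP r K (f g : fps r K) : f =1 g -> f = g.
Proof. by case: f g => [f] [g] /= /funext ->. Qed.

Section FpsRing.
Variables (r : nat) (K : comNzRingType).
Implicit Types (f g h : fps r K) (m : 'X_{1..r}).

Definition fpsC (c : K) : fps r K :=
  Fps (fun m => if m == 0%MM then c else 0).
Definition fps_opp f : fps r K := Fps (fun m => - f m).
Definition fps_add f g : fps r K := Fps (fun m => f m + g m).
Definition fps_mul f g : fps r K := Fps (fun m =>
  \sum_(k : 'X_{1..r < (mdeg m).+1, (mdeg m).+1} | m == (k.1 + k.2)%MM)
    f k.1 * g k.2).

Fact fps_addA : associative fps_add.
Proof. by move=> f g h; apply: fpsP => m /=; rewrite addrA. Qed.
Fact fps_addC : commutative fps_add.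
Proof. by move=> f g; apply: fpsP => m /=; rewrite addrC. Qed.
Fact fps_add0 : left_id (fpsC 0) fps_add.
Proof. by move=> f; apply: fpsP => m /=; rewrite if_same add0r. Qed.
Fact fps_addN : left_inverse (fpsC 0) fps_opp fps_add.
Proof. by move=> f; apply: fpsP => m /=; rewrite if_same addNr. Qed.

HB.instance Definition _ :=
  GRing.isZmodule.Build (fps r K) fps_addA fps_addC fps_add0 fps_addN.

Definition fps_trunc d f : {mpoly K[r]} :=
  \sum_(k : 'X_{1..r < d}) f k *: 'X_[k].

Lemma mcoeff_fps_trunc d f m :
  (fps_trunc d f)@_m = if (mdeg m < d)%N then f m else 0.
Proof.
rewrite /fps_trunc linear_sum /=; case: ltnP => [lt_md|le_dm].
  rewrite (bigD1 (BMultinom lt_md)) //= mcoeffZ mcoeffX eqxx mulr1 big1 ?addr0//.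
  move=> k /eqP kP; rewrite mcoeffZ mcoeffX; case: eqP => [e|]; rewrite ?mulr0//.
  by case: kP; apply: val_inj.
apply: big1 => k _; rewrite mcoeffZ mcoeffX; case: eqP => [e|]; rewrite ?mulr0//.
by have := bmdeg k; rewrite e ltnNge le_dm.
Qed.

Lemma mcoeffM_low d (p p' q q' : {mpoly K[r]}) m : (mdeg m < d)%N ->
  (forall k, (mdeg k < d)%N -> p@_k = p'@_k) ->
  (forall k, (mdeg k < d)%N -> q@_k = q'@_k) -> (p * q)@_m = (p' * q')@_m.
Proof.
move=> md ep eq; rewrite !mcoeffM; apply: eq_bigr => k _.
rewrite ep ?eq //; apply: leq_trans md; exact: bmdeg.
Qed.

Lemma fps_mul_trunc d f g m : (mdeg m < d)%N ->
  fps_mul f g m = (fps_trunc d f * fps_trunc d g)@_m.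
Proof.
move=> md; rewrite mcoeffM /=; apply: eq_bigr => k _.
by rewrite !mcoeff_fps_trunc !(leq_trans (bmdeg _) md).
Qed.

Fact fps_mulA : associative fps_mul.
Proof.
move=> f g h; apply: fpsP => m; rewrite !(fps_mul_trunc _ _ (ltnSn (mdeg m))).
set d := (mdeg m).+1.
rewrite (mcoeffM_low (d := d) (p' := fps_trunc d f)
  (q' := fps_trunc d g * fps_trunc d h)) //; last first.
  by move=> k kd; rewrite mcoeff_fps_trunc kd (fps_mul_trunc _ _ kd).
rewrite [RHS](mcoeffM_low (d := d) (p' := fps_trunc d f * fps_trunc d g)
  (q' := fps_trunc d h)) ?mulrA //.
by move=> k kd; rewrite mcoeff_fps_trunc kd (fps_mul_trunc _ _ kd).
Qed.

Fact fps_mulC : commutative fps_mul.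
Proof.
by move=> f g; apply: fpsP => m; rewrite !(fps_mul_trunc _ _ (ltnSn (mdeg m))) mulrC.
Qed.

Fact fps_mul1 : left_id (fpsC 1) fps_mul.
Proof.
move=> f; apply: fpsP => m; rewrite (fps_mul_trunc _ _ (ltnSn (mdeg m))).
rewrite (mcoeffM_low (d := (mdeg m).+1) (p' := 1)
  (q' := fps_trunc (mdeg m).+1 f)) ?mul1r ?mcoeff_fps_trunc ?ltnSn //.
by move=> k kd; rewrite mcoeff_fps_trunc kd mcoeff1 /=; case: (k == 0%MM).
Qed.

Fact fps_mulDl : left_distributive fps_mul fps_add.
Proof.
move=> f g h; apply: fpsP => m /=; rewrite -big_split /=.
by apply: eq_bigr => k _; rewrite mulrDl.
Qed.

Fact fps_oner_neq0 : fpsC 1 != fpsC 0.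
Proof.
apply/eqP => /(congr1 (fun f : fps r K => f 0%MM)) /= /eqP.
by rewrite eqxx oner_eq0.
Qed.

HB.instance Definition _ := GRing.Zmodule_isComNzRing.Build (fps r K)
  fps_mulA fps_mulC fps_mul1 fps_mulDl fps_oner_neq0.

Definition fpsX (i : 'I_r) : fps r K :=
  Fps (fun m => if m == U_(i)%MM then 1 else 0).

Definition fps_ord f (d : nat) : Prop :=
  (exists2 m, mdeg m = d & f m != 0) /\
  (forall m, (mdeg m < d)%N -> f m = 0).

End FpsRing.

Arguments fpsC {r K} c.
Arguments fpsX {r K} i.

Section Substitution.
Variables (r s : nat) (K : comNzRingType).

(* f(xi_1, .., xi_r). Meaningful only when the xi_i have no constant term:
   then xi^k has no monomial of degree < mdeg k, so that the coefficient at m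
   of the infinite sum \sum_k f_k xi^k only involves mdeg k <= mdeg m.        *)
Definition fps_subst (xi : r.-tuple (fps s K)) (f : fps r K) : fps s K :=
  Fps (fun m => \sum_(k : 'X_{1..r < (mdeg m).+1})
                  f k * (\prod_(i < r) tnth xi i ^+ (k : 'X_{1..r}) i : fps s K) m).

End Substitution.

Section ValuedField.
Variables (R : realType) (K : fieldType) (v : K -> R).

Definition absolute_value : Prop :=
  [/\ forall x, 0 <= v x,
      forall x, v x = 0 <-> x = 0,
      forall x y, v (x * y) = v x * v y &
      forall x y, v (x + y) <= v x + v y].

Definition nontrivial_absolute_value : Prop :=
  exists2 x, x != 0 & v x != 1.

Definition complete_absolute_value : Prop :=
  forall u : nat -> K,
    (forall e : R, 0 < e -> exists N : nat,
       forall i j, (N <= i)%N -> (N <= j)%N -> v (u i - u j) < e) ->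
    exists l : K, forall e : R, 0 < e -> exists N : nat,
       forall i, (N <= i)%N -> v (u i - l) < e.

(* K{x_1, .., x_r}. Convergence on some polydisc amounts to Cauchy estimates
   with one common positive radius.                                           *)
Definition convergent (r : nat) : set (fps r K) :=
  [set f | exists rho C : R,
     0 < rho /\ forall m, v (f m) * rho ^+ mdeg m <= C].

(* K{xi_1, .., xi_r}, a subalgebra of K{t} *)
Definition analytic_subalgebra (r : nat) (xi : r.-tuple (fps 1 K)) :
  set (fps 1 K) := fps_subst xi @` @convergent r.

(* kernel of K{x_1, .., x_r} -> K{t}, x_i |-> xi_i *)
Definition curve_ideal (r : nat) (xi : r.-tuple (fps 1 K)) : set (fps r K) :=
  [set f | convergent f /\ fps_subst xi f = 0].

Definition generated_ideal (r s : nat) (F : s.-tuple (fps r K)) :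
  set (fps r K) :=
  [set h | exists2 c : 'I_s -> fps r K, (forall i, convergent (c i)) &
             h = \sum_(i < s) c i * tnth F i].

Definition radical (r : nat) (I : set (fps r K)) : set (fps r K) :=
  [set h | convergent h /\ exists k : nat, I (h ^+ k)].

(* The prime ideal of a space curve germ has height two. *)
Definition set_theoretic_ci_space_curve (xi : 3.-tuple (fps 1 K)) : Prop :=
  exists2 F : 2.-tuple (fps 3 K), (forall i, convergent (tnth F i)) &
    radical (curve_ideal xi) = radical (generated_ideal F).

Definition value_semigroup (O : set (fps 1 K)) : set nat :=
  [set d | exists2 h, O h & fps_ord h d].

(* K-algebra isomorphism; phi is only relevant on A. Preservation of 1 and of
   scalars is preservation of constant series.                                *)
Definition isomorphic_subalgebras (A B : set (fps 1 K)) : Prop :=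
  exists phi : fps 1 K -> fps 1 K,
    [/\ set_bij A B phi,
        forall c, phi (fpsC c) = fpsC c,
        forall f g, A f -> A g -> phi (f + g) = phi f + phi g &
        forall f g, A f -> A g -> phi (f * g) = phi f * phi g].

End ValuedField.

Definition numerical_semigroup (l m n : nat) : set nat :=
  [set k | exists i j h : nat, k = (i * l + j * m + h * n)%N].

Definition is_conductor (S : set nat) (c : nat) : Prop :=
  (forall k, (c <= k)%N -> S k) /\
  (forall c', (forall k, (c' <= k)%N -> S k) -> (c <= c')%N).

Section MonomialCurve.
Variable K : comNzRingType.

Definition tvar : fps 1 K := fpsX ord0.

Definition monomial_curve (l m n : nat) : 3.-tuple (fps 1 K) :=
  [tuple tvar ^+ l; tvar ^+ m; tvar ^+ n].

Definition deformed_curve (l m n p q : nat) : 3.-tuple (fps 1 K) :=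
  [tuple tvar ^+ l; tvar ^+ m + tvar ^+ p; tvar ^+ n + tvar ^+ q].

End MonomialCurve.

(* Main.v *)
Require Import Defs.
From HB Require Import structures.
From mathcomp Require Import all_boot all_order all_algebra.
From mathcomp Require Import boolp classical_sets functions reals.
From mathcomp Require Import mpoly.
From mathcomp Require Import zify ring lra.

Set Implicit Arguments.
Unset Strict Implicit.
Unset Printing Implicit Defensive.

Import Order.TTheory GRing.Theory Num.Theory.
Local Open Scope ring_scope.

(** Put [x = t ^ l], [y = t ^ m + t ^ p], [z = t ^ n + t ^ q], and give the
    coordinates of 3-space the weights [l], [m], [n]. The equations
    [y z = x ^ a.+1], [z ^ 2 = x y ^ b], [y ^ b.+1 = x ^ a z] of the monomial
    curve are the minors of the matrix [(x ^ a, y ^ b, z; y, z, x)], and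
    [d1 = (a + 1) l = m + n] is the least weight shared by two distinct
    monomials (Lemma [rep_unique]).

    Value semigroup. A monomial of weight [w] takes the value [t ^ w] up to
    order [w + delta]. Hence two monomials of the same weight, which is at
    least [d1], agree up to order [d1 + delta >= gamma]. Thus cancellation of
    leading terms does not produce new orders below [gamma] (Lemmas
    [ev_drop_low] and [value_in_semigroup]), and from [gamma] on all orders are
    in the semigroup.

    Complete intersection. The elements [y z / x] and [z ^ 2 / x] of [K{t}]
    differ from [x ^ a] and [y ^ b] by series of order at least
    [d1 - l + delta >= gamma]. Such series belong to the ring of the curve
    (Lemma [representation]). So there are series [alpha] and [beta] with these
    values, and the minors of [(alpha, beta, z; y, z, x)] vanish on the curve.
    They generate its ideal: division by the minors, with leading monomials
    [y z], [y ^ b.+1], [z ^ 2], leaves a remainder in the monomials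
    [x ^ i y ^ j] with [j <= b] and [x ^ i z], whose orders on the curve are distinct (Lemma
    [minors_generate]). As the last two columns of the matrix are symmetric, two
    elements of the ideal of minors generate it up to radical (Lemma
    [determinantal_ci]).

    Non-monomiality. Let [p = gamma - 1 - l], a gap of the semigroup whose sum
    with [l] is the largest gap. If the curve were isomorphic to the monomial
    one, its ring would contain [t ^ l V ^ l] and [t ^ m V ^ m] for some unit [V]
    (Lemma [isomorphic_monomial]). As long as these have no gap terms, the
    exponents of [V] lie in the monoid of degrees of derivations of the monomial
    curve. Since [p - m + l] and [p] are gaps, the coefficient of [t ^ p] in
    [t ^ m V ^ m] is 0, although [y] contributes to it (Lemma [not_monomial]).
    This supposes that [m] is not 0 in [K]; if it is, the derivative of [V ^ m]
    vanishes, which gives the same conclusion.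

    All constructions of convergent series are instances of one fixed point
    (Lemma [division]), which is solved by successive approximation with respect
    to weights and estimated in an l1-norm. *)

(** * Power series: monomials, weights and supports *)

Section Weights.
Variables (r : nat) (w : 'I_r -> nat).
Implicit Types k : 'X_{1..r}.

Definition wt k : nat := (\sum_i w i * k i)%N.

Lemma wtD k1 k2 : wt (k1 + k2)%MM = (wt k1 + wt k2)%N.
Proof.
by rewrite /wt -big_split; apply: eq_bigr => i _ /=; rewrite mnmDE mulnDr.
Qed.

Lemma mdeg_le_wt k : (forall i, 0 < w i)%N -> (mdeg k <= wt k)%N.
Proof.
move=> w_gt0; rewrite mdegE; apply: leq_sum => i _.
by rewrite leq_pmull.
Qed.

End Weights.

Lemma wt_const1 r (k : 'X_{1..r}) : wt (fun=> 1%N) k = mdeg k.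
Proof. by rewrite mdegE; apply: eq_bigr => i _; rewrite mul1n. Qed.

Section Support.
Variables (r : nat) (K : comNzRingType).
Implicit Types (f g h : fps r K) (k M : 'X_{1..r}) (w : 'I_r -> nat).

Lemma fps_coef0 k : (0 : fps r K) k = 0.
Proof. by rewrite /= if_same. Qed.

Lemma fps_coef1 k : (1 : fps r K) k = (k == 0%MM)%:R.
Proof. by rewrite /=; case: eqP. Qed.

Lemma fps_coefD f g k : (f + g) k = f k + g k. Proof. by []. Qed.
Lemma fps_coefN f k : (- f) k = - f k. Proof. by []. Qed.
Lemma fps_coefB f g k : (f - g) k = f k - g k. Proof. by []. Qed.

Lemma fps_coef_sum I (s : seq I) (P : pred I) (F : I -> fps r K) k :
  (\sum_(i <- s | P i) F i) k = \sum_(i <- s | P i) F i k.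
Proof.
by apply: (big_morph (fun f : fps r K => f k)) => //; rewrite fps_coef0.
Qed.

(** The definition of the product sums over an index type that depends on
    the exponent; a uniform bound on exponents allows to exchange sums. *)
Lemma fps_coefM f g k d : (mdeg k < d)%N ->
  (f * g) k = \sum_(c : 'X_{1..r < d, d} | k == (c.1 + c.2)%MM) f c.1 * g c.2.
Proof.
move=> kd; rewrite [LHS](fps_mul_trunc f g kd) (mcoeff_poly_mul _ _ kd).
by apply: eq_bigr => c _; rewrite !mcoeff_fps_trunc !bmdeg.
Qed.

Lemma fps_coefM_eq0 f g k :
  (forall a b, k = (a + b)%MM -> f a * g b = 0) -> (f * g) k = 0.
Proof.
move=> fg0; rewrite (fps_coefM f g (ltnSn _)) big1 // => c /eqP; exact: fg0.
Qed.

Lemma fps_coefMC c f k : (fpsC c * f) k = c * f k.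
Proof.
rewrite (fps_coefM _ _ (ltnSn (mdeg k))).
have lt0 : (mdeg (0%MM : 'X_{1..r}) < (mdeg k).+1)%N by rewrite mdeg0.
rewrite (bigD1 (BMultinom lt0, BMultinom (ltnSn (mdeg k)))) /= ?add0m //.
rewrite eqxx big1 ?addr0 // => -[[u ud] [u' u'd]] /= /andP[/eqP ek ne].
case: eqP => [u0|]; rewrite ?mul0r //.
by case/eqP: ne; congr (_, _); apply: val_inj => //=; rewrite ek u0 add0m.
Qed.

Definition Xmon M : fps r K := Fps (fun k => (k == M)%:R).

Lemma fpsXE i : fpsX i = Xmon U_(i)%MM.
Proof. by apply: fpsP => k /=; case: eqP. Qed.

Lemma Xmon0 : Xmon 0%MM = 1.
Proof. by apply: fpsP => k; rewrite fps_coef1. Qed.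

Lemma Xmon_mul_shift M f k : (Xmon M * f) (M + k)%MM = f k.
Proof.
rewrite (fps_coefM _ _ (ltnSn _)); set d := (mdeg (M + k)).+1.
have ltM : (mdeg M < d)%N by rewrite ltnS mdegD leq_addr.
have ltk : (mdeg k < d)%N by rewrite ltnS mdegD leq_addl.
rewrite (bigD1 (BMultinom ltM, BMultinom ltk)) /= ?eqxx // mul1r.
rewrite big1 ?addr0 // => -[[u ud] [u' u'd]] /= /andP[/eqP ek ne].
case: eqP => [u0|]; rewrite ?mul0r //; case/eqP: ne.
congr (_, _); apply: val_inj => //=.
by move: ek; rewrite u0 => /addmI.
Qed.

Lemma Xmon_mul_coef M f k :
  (Xmon M * f) k = if (M <= k)%MM then f (k - M)%MM else 0.
Proof.
case: ifPn => [leMk|nle].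
  by rewrite -{1}(submK leMk) addmC Xmon_mul_shift.
apply: fps_coefM_eq0 => a b ek /=; case: eqP => [ea|]; rewrite ?mul0r //.
by case/negP: nle; rewrite ek ea lem_addr.
Qed.

Lemma XmonM M N : Xmon M * Xmon N = Xmon (M + N)%MM.
Proof.
apply: fpsP => k; rewrite Xmon_mul_coef /=.
case: ifPn => [leMk|nle].
  by rewrite -{2}(submK leMk) addmC eqm_add2l.
by case: eqP nle => // ->; rewrite lem_addr.
Qed.

Lemma XmonX M e : Xmon M ^+ e = Xmon (M *+ e)%MM.
Proof.
by elim: e => [|e IH]; rewrite ?expr0 ?mulm0n ?Xmon0 // exprS IH XmonM mulmS.
Qed.

(** The quotient by [X^M] of the part of [f] on the exponents [M + k], where
    [k] is selected by [P]. *)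
Definition strip (P : pred 'X_{1..r}) M f : fps r K :=
  Fps (fun k => if P k then f (M + k)%MM else 0).

Lemma stripB P M f g : strip P M (f - g) = strip P M f - strip P M g.
Proof. by apply: fpsP => k /=; case: ifP; rewrite ?subr0. Qed.

Definition vanish_below w d f := forall k, (wt w k < d)%N -> f k = 0.

Section Order.
Variable w : 'I_r -> nat.

Lemma vanish_belowW d e f :
  (e <= d)%N -> vanish_below w d f -> vanish_below w e f.
Proof. by move=> led f0 k lt; apply/f0/(leq_trans lt). Qed.

Lemma vanish_belowD d f g :
  vanish_below w d f -> vanish_below w d g -> vanish_below w d (f + g).
Proof. by move=> f0 g0 k lt; rewrite fps_coefD f0 ?g0 ?addr0. Qed.

Lemma vanish_belowN d f : vanish_below w d f -> vanish_below w d (- f).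
Proof. by move=> f0 k lt; rewrite fps_coefN f0 ?oppr0. Qed.

Lemma vanish_belowB d f g :
  vanish_below w d f -> vanish_below w d g -> vanish_below w d (f - g).
Proof. by move=> f0 g0; apply: vanish_belowD => //; apply: vanish_belowN. Qed.

Lemma vanish_below_sum d I (s : seq I) (P : pred I) (F : I -> fps r K) :
  (forall i, P i -> vanish_below w d (F i)) ->
  vanish_below w d (\sum_(i <- s | P i) F i).
Proof. by move=> F0 k lt; rewrite fps_coef_sum big1 // => i /F0; apply. Qed.

Lemma vanish_belowM d e f g :
  vanish_below w d f -> vanish_below w e g -> vanish_below w (d + e) (f * g).
Proof.
move=> f0 g0 k lt; apply: fps_coefM_eq0 => a b ek.
move: lt; rewrite ek wtD; case: (ltnP (wt w a) d) => [/f0-> _|leda lt].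
  by rewrite mul0r.
by rewrite g0 ?mulr0 // -(ltn_add2l d) (leq_ltn_trans _ lt) // leq_add2r.
Qed.

Lemma vanish_belowX d e f :
  vanish_below w d f -> vanish_below w (d * e) (f ^+ e).
Proof.
move=> f0; elim: e => [|e IH]; first by rewrite muln0.
by rewrite exprS mulnS; apply: vanish_belowM.
Qed.

Lemma vanish_below_Xmon M : vanish_below w (wt w M) (Xmon M).
Proof. by move=> k; rewrite /=; case: eqP => [->|//]; rewrite ltnn. Qed.

Lemma vanish_below_strip P M d f : vanish_below w (wt w M + d) f ->
  vanish_below w d (strip P M f).
Proof.
by move=> f0 k lt; rewrite /=; case: ifP => // _; rewrite f0 // wtD ltn_add2l.
Qed.

End Order.
End Support.

Arguments Xmon {r K} M.

Section FpsC.
Variables (r : nat) (K : comNzRingType).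

Fact fpsC_is_zmod_morphism : zmod_morphism (@fpsC r K).
Proof. by move=> c e; apply: fpsP => k /=; case: ifP; rewrite ?subr0. Qed.

Fact fpsC_is_monoid_morphism : monoid_morphism (@fpsC r K).
Proof.
split=> [|c e]; first by [].
by apply: fpsP => k; rewrite fps_coefMC /=; case: ifP; rewrite ?mulr0.
Qed.

HB.instance Definition _ :=
  GRing.isZmodMorphism.Build K (fps r K) (@fpsC r K) fpsC_is_zmod_morphism.
HB.instance Definition _ :=
  GRing.isMonoidMorphism.Build K (fps r K) (@fpsC r K) fpsC_is_monoid_morphism.

End FpsC.

(** * Convergence *)

Section Norm.
Variables (R : realType) (K : fieldType) (v : K -> R).
Hypothesis v_abs : absolute_value v.

Lemma abs_ge0 x : 0 <= v x. Proof. by case: v_abs. Qed.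
Lemma abs0 : v 0 = 0. Proof. by case: v_abs => _ /(_ 0) [_ ->]. Qed.
Lemma absM x y : v (x * y) = v x * v y. Proof. by case: v_abs. Qed.
Lemma absD x y : v (x + y) <= v x + v y. Proof. by case: v_abs. Qed.

Lemma abs1 : v 1 = 1.
Proof.
have v1 : v 1 != 0.
  by apply/eqP; case: v_abs => _ /(_ 1) [v1 _] _ _ /v1 /eqP; rewrite oner_eq0.
by apply: (mulfI v1); rewrite -absM !mulr1.
Qed.

Lemma absN x : v (- x) = v x.
Proof.
suff vN1 : v (-1) = 1 by rewrite -mulN1r absM vN1 mul1r.
apply/eqP; rewrite -(@eqrXn2 _ 2) ?abs_ge0 ?ler01 //.
by rewrite expr2 -absM mulrNN mulr1 abs1 expr1n.
Qed.

Lemma abs_sum I (s : seq I) (P : pred I) (F : I -> K) :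
  v (\sum_(i <- s | P i) F i) <= \sum_(i <- s | P i) v (F i).
Proof.
elim/big_rec2: _ => [|i x y _ le]; first by rewrite abs0.
by rewrite (le_trans (absD _ _)) // lerD2l.
Qed.

Section L1.
Variables (r : nat) (w : 'I_r -> nat).
Implicit Types (f g h tau : fps r K) (s C : R) (d : nat).

Definition l1_part s f d : R := \sum_(k : 'X_{1..r < d}) v (f k) * s ^+ wt w k.

(** Absolute convergence on the polydisc of radii [s ^+ w i], with bound
    [C].  Unlike the supremum norm of the Cauchy estimates, this norm is
    submultiplicative without any ultrametric inequality. *)
Definition l1_le s C f := forall d, l1_part s f d <= C.

Lemma l1_part_ge0 s f d : 0 <= s -> 0 <= l1_part s f d.
Proof.
by move=> s_ge0; apply: sumr_ge0 => k _; rewrite mulr_ge0 ?abs_ge0 ?exprn_ge0.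
Qed.

Lemma l1_le_ge0 s C f : l1_le s C f -> 0 <= C.
Proof.
by move=> /(_ 0%N); apply: le_trans; apply: sumr_ge0 => -[k kd]; exfalso.
Qed.

Lemma l1_leW s C C' f : C <= C' -> l1_le s C f -> l1_le s C' f.
Proof. by move=> CC' fC d; apply: le_trans (fC d) CC'. Qed.

Lemma l1_le0 s : l1_le s 0 0.
Proof.
by move=> d; rewrite /l1_part big1 // => k _; rewrite fps_coef0 abs0 mul0r.
Qed.

Lemma l1_leD s C C' f g : 0 <= s ->
  l1_le s C f -> l1_le s C' g -> l1_le s (C + C') (f + g).
Proof.
move=> s_ge0 fC gC d; apply: le_trans (lerD (fC d) (gC d)).
rewrite -big_split; apply: ler_sum => k _ /=.
by rewrite -mulrDl ler_wpM2r ?exprn_ge0 ?absD.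
Qed.

Lemma l1_le_sum s n (C : 'I_n -> R) (F : 'I_n -> fps r K) : 0 <= s ->
  (forall i, l1_le s (C i) (F i)) -> l1_le s (\sum_i C i) (\sum_i F i).
Proof.
move=> s_ge0 FC; elim/big_rec2: _ => [|i f c _ fc]; first exact: l1_le0.
exact: l1_leD.
Qed.

Lemma l1_leM s C C' f g : 0 <= s ->
  l1_le s C f -> l1_le s C' g -> l1_le s (C * C') (f * g).
Proof.
move=> s_ge0 fC gC d.
pose F k := v (f k) * s ^+ wt w k; pose G k := v (g k) * s ^+ wt w k.
apply: (@le_trans _ _ (l1_part s f d * l1_part s g d)); last first.
  by apply: ler_pM; rewrite ?l1_part_ge0.
have -> : l1_part s f d * l1_part s g d =
    \sum_(c : 'X_{1..r < d, d}) F c.1 * G c.2.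
  by rewrite /l1_part big_distrlr pair_bigA.
apply: (@le_trans _ _ (\sum_(k : 'X_{1..r < d})
    \sum_(c : 'X_{1..r < d, d} | k == (c.1 + c.2)%MM :> 'X_{1..r})
      F c.1 * G c.2)).
  apply: ler_sum => k _; rewrite (fps_coefM _ _ (bmdeg k)).
  rewrite (le_trans (ler_wpM2r _ (abs_sum _ _ _))) ?exprn_ge0 //.
  rewrite mulr_suml; apply: ler_sum => c /eqP ->.
  by rewrite absM wtD exprD mulrACA.
rewrite (exchange_big_dep xpredT) //=; apply: ler_sum => c _.
have FG0 : 0 <= F c.1 * G c.2 by rewrite !mulr_ge0 ?abs_ge0 ?exprn_ge0.
case: (ltnP (mdeg (c.1 + c.2)%MM) d) => [lt|le].
  by rewrite (big_pred1 (BMultinom lt)).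
rewrite big_pred0 // => k; apply/eqP => e.
by have := bmdeg k; rewrite e ltnNge le.
Qed.

Lemma l1_le_strip s C (P : pred 'X_{1..r}) M f : 0 < s ->
  l1_le s C f -> l1_le s (C / s ^+ wt w M) (strip P M f).
Proof.
move=> s_gt0 fC d; rewrite ler_pdivlMr ?exprn_gt0 // mulr_suml.
pose F k := v (f k) * s ^+ wt w k.
have F0 k : 0 <= F k by rewrite mulr_ge0 ?abs_ge0 ?exprn_ge0 ?ltW.
have sub (k : 'X_{1..r < d}) : (mdeg (M + k)%MM < mdeg M + d)%N.
  by rewrite mdegD ltn_add2l bmdeg.
pose phi k := BMultinom (sub k).
have phi_inj : injective phi.
  by move=> k k' /(congr1 val) /= /addmI /val_inj.
apply: (@le_trans _ _ (\sum_k F (phi k))).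
  apply: ler_sum => k _; rewrite /F /= wtD addnC exprD mulrA.
  rewrite ler_wpM2r ?ler_wpM2r ?exprn_ge0 ?(ltW s_gt0) //.
  by case: ifP => // _; rewrite abs0 abs_ge0.
apply: le_trans (fC (mdeg M + d)%N).
rewrite -(big_imset (fun k : 'X_{1..r < mdeg M + d} => F k) (A := predT)) /=;
  last by move=> k k' _ _ /phi_inj.
rewrite /l1_part [leRHS](bigID (mem (phi @: predT))) /= lerDl.
by apply: sumr_ge0 => k _; exact: F0.
Qed.

Lemma l1_le_shrink s s' C f : 0 < s' -> s' <= s -> l1_le s C f -> l1_le s' C f.
Proof.
move=> s'0 s's fC d; apply: le_trans (fC d); apply: ler_sum => k _.
have s0 := lt_le_trans s'0 s's.
by rewrite ler_wpM2l ?abs_ge0 // lerXn2r // nnegrE ltW.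
Qed.

(** The gain [s / s0] per unit of weight: a series all of whose weights exceed
    [N] has norm [o(s ^+ N)] as the radius [s] tends to 0. *)
Lemma l1_le_vanish s0 C N tau eps : 0 < s0 -> 0 < eps ->
  l1_le s0 C tau -> vanish_below w N.+1 tau ->
  exists2 s1, 0 < s1 & forall s, 0 < s -> s <= s1 -> l1_le s (eps * s ^+ N) tau.
Proof.
move=> s0_gt0 eps_gt0 tauC tau0.
have C0 := l1_le_ge0 tauC.
have C1_gt0 : 0 < C + 1 by apply: ltr_wpDl.
have e0 : 0 < s0 ^+ N.+1 by rewrite exprn_gt0.
exists (Order.min s0 (eps * s0 ^+ N.+1 / (C + 1))).
  by rewrite lt_min s0_gt0 !mulr_gt0 // invr_gt0.
move=> s s_gt0; rewrite le_min => /andP[ss0 sle] d.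
apply: (@le_trans _ _ ((s / s0) ^+ N.+1 * l1_part s0 tau d)).
  rewrite /l1_part mulr_sumr; apply: ler_sum => k _.
  case: (leqP N.+1 (wt w k)) => [le|/tau0->]; last by rewrite abs0 !mul0r mulr0.
  rewrite mulrCA ler_wpM2l ?abs_ge0 //.
  have -> : s ^+ wt w k = (s / s0) ^+ wt w k * s0 ^+ wt w k.
    by rewrite -exprMn divfK // gt_eqF.
  rewrite ler_wpM2r ?exprn_ge0 ?(ltW s0_gt0) // ler_wiXn2l //.
    by rewrite divr_ge0 ?ltW.
  by rewrite ler_pdivrMr // mul1r.
apply: (@le_trans _ _ ((s / s0) ^+ N.+1 * (C + 1))).
  rewrite ler_wpM2l ?exprn_ge0 ?divr_ge0 ?(ltW s_gt0) ?(ltW s0_gt0) //.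
  by rewrite (le_trans (tauC d)) // lerDl.
move: sle; rewrite ler_pdivlMr // => sle.
rewrite expr_div_n mulrAC ler_pdivrMr // exprSr -mulrA [eps * _]mulrC -mulrA.
by rewrite ler_wpM2l // exprn_ge0 // ltW.
Qed.

End L1.

Lemma geometric_le (t : R) d : 0 <= t -> t <= 2^-1 -> \sum_(j < d) t ^+ j <= 2.
Proof.
move=> t0 t1; have h : (1 - t) * \sum_(j < d) t ^+ j = 1 - t ^+ d.
  by rewrite -[RHS]opprB subrX1 -mulNr opprB.
have : 0 <= t ^+ d by rewrite exprn_ge0.
have : 0 <= \sum_(j < d) t ^+ j by apply: sumr_ge0 => j _; rewrite exprn_ge0.
nra.
Qed.

(** Comparison with a product of [r] geometric series. *)
Lemma sum_monomials_le r (t : R) d : 0 <= t -> t <= 2^-1 ->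
  \sum_(k : 'X_{1..r < d}) t ^+ mdeg k <= 2 ^+ r.
Proof.
move=> t0 t1; case: d => [|d].
  by rewrite big1 ?exprn_ge0 // => -[k kd]; exfalso.
have bnd (k : 'X_{1..r < d.+1}) i : ((k : 'X_{1..r}) i < d.+1)%N.
  by apply: leq_ltn_trans (bmdeg k); rewrite mdegE (bigD1 i) //= leq_addr.
pose phi (k : 'X_{1..r < d.+1}) := [ffun i => Ordinal (bnd k i)].
have phi_inj : injective phi.
  move=> k k' /ffunP e; apply/val_inj/mnmP => i.
  by have /(congr1 val) := e i; rewrite !ffunE.
pose F (g : {ffun 'I_r -> 'I_d.+1}) := \prod_i t ^+ g i.
have -> : \sum_(k : 'X_{1..r < d.+1}) t ^+ mdeg k = \sum_k F (phi k).
  apply: eq_bigr => k _; rewrite mdegE -prodrXr; apply: eq_bigr => i _.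
  by rewrite ffunE.
rewrite -(big_imset F (A := predT)) /=; last by move=> k k' _ _ /phi_inj.
apply: (@le_trans _ _ (\sum_g F g)).
  rewrite [leRHS](bigID (mem (phi @: predT))) /= lerDl.
  by apply: sumr_ge0 => g _; apply: prodr_ge0 => i _; rewrite exprn_ge0.
rewrite /F -(bigA_distr_bigA (fun (_ : 'I_r) (j : 'I_d.+1) => t ^+ j)) /=.
rewrite prodr_const card_ord.
apply: lerXn2r; rewrite ?nnegrE ?geometric_le //.
by apply: sumr_ge0 => j _; rewrite exprn_ge0.
Qed.

Section Convergent.
Variables (r : nat) (w : 'I_r -> nat).
Hypothesis w_gt0 : forall i, (0 < w i)%N.
Implicit Types (f g h tau : fps r K) (s C : R).

Lemma convergent_l1 f : convergent v f ->
  exists s C, 0 < s /\ l1_le w s C f.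
Proof.
move=> [rho [C [rho_gt0 fC]]].
have C0 : 0 <= C.
  by apply: le_trans (fC 0%MM); rewrite mulr_ge0 ?abs_ge0 ?exprn_ge0 ?ltW.
pose s := Order.min 1 (rho / 2).
have s_gt0 : 0 < s by rewrite lt_min ltr01 divr_gt0.
have s_le1 : s <= 1 by rewrite ge_min lexx.
have srho : s / rho <= 2^-1.
  by rewrite ler_pdivrMr // mulrC ge_min lexx orbT.
exists s, (C * 2 ^+ r); split=> // d.
have t0 : 0 <= s / rho by rewrite divr_ge0 ?ltW.
apply: le_trans (ler_wpM2l C0 (sum_monomials_le r d t0 srho)).
rewrite mulr_sumr; apply: ler_sum => k _.
apply: (@le_trans _ _ (v (f k) * s ^+ mdeg k)).
  by rewrite ler_wpM2l ?abs_ge0 // ler_wiXn2l ?mdeg_le_wt // ltW.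
rewrite expr_div_n mulrA ler_pdivlMr ?exprn_gt0 // mulrAC ler_wpM2r //.
by rewrite exprn_ge0 // ltW.
Qed.

Lemma l1_convergent s C f : 0 < s -> l1_le w s C f -> convergent v f.
Proof.
move=> s_gt0 fC; pose s1 := Order.min 1 s.
have s1_gt0 : 0 < s1 by rewrite lt_min ltr01.
have s1_le1 : s1 <= 1 by rewrite ge_min lexx.
pose N := (\sum_i w i)%N.
exists (s1 ^+ N), C; split=> [|k]; first by rewrite exprn_gt0.
have kd := ltnSn (mdeg k); apply: le_trans (fC (mdeg k).+1).
rewrite /l1_part (bigD1 (BMultinom kd)) //= ler_wpDr //.
  by apply: sumr_ge0 => i _; rewrite mulr_ge0 ?abs_ge0 ?exprn_ge0 ?ltW.
rewrite ler_wpM2l ?abs_ge0 // -exprM.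
apply: (@le_trans _ _ (s1 ^+ wt w k)).
  rewrite ler_wiXn2l ?(ltW s1_gt0) // /wt mdegE big_distrr /=.
  apply: leq_sum => i _; rewrite leq_mul2r /N (bigD1 i) //=.
  by rewrite leq_addr orbT.
by rewrite lerXn2r ?nnegrE ?(ltW s1_gt0) ?(ltW s_gt0) // ge_min lexx orbT.
Qed.

Lemma convergent_l1_small f : convergent v f ->
  exists2 s0, 0 < s0 & exists C, forall s, 0 < s -> s <= s0 -> l1_le w s C f.
Proof.
move=> /convergent_l1 [s0 [C [s0_gt0 fC]]]; exists s0 => //.
exists C => s s0' le.
exact: l1_le_shrink fC.
Qed.

End Convergent.

Section ConvergentRing.
Variable r : nat.
Implicit Types (f g : fps r K).

Let w1_gt0 (i : 'I_r) : (0 < (fun=> 1) i)%N. Proof. by []. Qed.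

Lemma convergent_mon M : convergent v (Xmon M : fps r K).
Proof.
exists 1, 1; split=> // k; rewrite expr1n mulr1 /=.
by case: eqP => _; rewrite ?abs1 ?abs0 ?ler01.
Qed.

Lemma convergentC c : convergent v (fpsC c : fps r K).
Proof.
exists 1, (v c); split=> // k; rewrite expr1n mulr1 /=.
by case: ifP; rewrite ?abs0 ?abs_ge0.
Qed.

Lemma convergent0 : convergent v (0 : fps r K). Proof. exact: convergentC. Qed.
Lemma convergent1 : convergent v (1 : fps r K). Proof. exact: convergentC. Qed.

Lemma convergent_nat e : convergent v (e%:R : fps r K).
Proof. by rewrite -(rmorph_nat (@fpsC r K)); apply: convergentC. Qed.

Lemma convergentN f : convergent v f -> convergent v (- f).
Proof.
move=> [rho [C [rho0 fC]]]; exists rho, C; split=> // k.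
by rewrite fps_coefN absN.
Qed.

Lemma convergentD f g :
  convergent v f -> convergent v g -> convergent v (f + g).
Proof.
move=> /(convergent_l1_small w1_gt0) [s s0 [C fC]].
move=> /(convergent_l1_small w1_gt0) [t t0 [D gD]].
have m0 : 0 < Order.min s t by rewrite lt_min s0.
apply: (l1_convergent (w := fun=> 1%N) m0); apply: l1_leD; first exact: ltW.
  by apply: fC; rewrite // ge_min lexx.
by apply: gD; rewrite // ge_min lexx orbT.
Qed.

Lemma convergentM f g :
  convergent v f -> convergent v g -> convergent v (f * g).
Proof.
move=> /(convergent_l1_small w1_gt0) [s s0 [C fC]].
move=> /(convergent_l1_small w1_gt0) [t t0 [D gD]].
have m0 : 0 < Order.min s t by rewrite lt_min s0.
apply: (l1_convergent (w := fun=> 1%N) m0); apply: l1_leM; first exact: ltW.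
  by apply: fC; rewrite // ge_min lexx.
by apply: gD; rewrite // ge_min lexx orbT.
Qed.

Lemma convergentB f g :
  convergent v f -> convergent v g -> convergent v (f - g).
Proof. by move=> fc gc; apply: convergentD => //; apply: convergentN. Qed.

Lemma convergentX f e : convergent v f -> convergent v (f ^+ e).
Proof.
move=> fc; elim: e => [|e IH]; first exact: convergent1.
by rewrite exprS; apply: convergentM.
Qed.

Lemma convergent_sum I (s : seq I) (P : pred I) (F : I -> fps r K) :
  (forall i, P i -> convergent v (F i)) ->
  convergent v (\sum_(i <- s | P i) F i).
Proof.
move=> Fc; elim/big_ind: _ => //; first exact: convergent0.
exact: convergentD.
Qed.

Lemma convergent_prod I (s : seq I) (P : pred I) (F : I -> fps r K) :
  (forall i, P i -> convergent v (F i)) ->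
  convergent v (\prod_(i <- s | P i) F i).
Proof.
move=> Fc; elim/big_ind: _ => //; first exact: convergent1.
exact: convergentM.
Qed.

Lemma convergent_strip (P : pred 'X_{1..r}) M f :
  convergent v f -> convergent v (strip P M f).
Proof.
move=> /(convergent_l1_small w1_gt0) [s s0 [C fC]].
apply: (l1_convergent (w := fun=> 1%N) s0); apply: l1_le_strip => //.
exact: fC.
Qed.

End ConvergentRing.

Lemma common_radius n (Q : 'I_n -> R -> Prop) :
  (forall i, exists2 s0, 0 < s0 & forall s, 0 < s -> s <= s0 -> Q i s) ->
  exists2 s0, 0 < s0 & forall s, 0 < s -> s <= s0 -> forall i, Q i s.
Proof.
elim: n Q => [|n IH] Q HQ; first by exists 1 => // s _ _ [].
have [i|s0 s0_gt0 H0] := IH (fun i => Q (lift ord0 i)); first exact: HQ.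
have [s1 s1_gt0 H1] := HQ ord0.
exists (Order.min s0 s1) => [|s s_gt0]; first by rewrite lt_min s0_gt0.
rewrite le_min => /andP[le0 le1] i.
by case: (unliftP ord0 i) => [j|] ->; [apply: H0|apply: H1].
Qed.

(** Division with remainder, inversion of units and changes of bases over
    [K{x}] are all instances of this fixed point equation. If each [tau i] lies
    in weights above that of [X^(M i)], then the linear operator
    [u |-> \sum_i strip u * tau i] raises weights. So the iterates of
    [u |-> h + \sum_i strip u * tau i] stabilize coefficientwise. On small
    polydiscs the operator halves the norm, which bounds all iterates and hence
    their limit. *)
Lemma division r (w : 'I_r -> nat) n (M : 'I_n -> 'X_{1..r})
    (P : 'I_n -> pred 'X_{1..r}) (tau : 'I_n -> fps r K) (h : fps r K) :
  (forall i, 0 < w i)%N ->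
  (forall i, vanish_below w (wt w (M i)).+1 (tau i)) ->
  exists2 u, u = h + \sum_i strip (P i) (M i) u * tau i &
    convergent v h -> (forall i, convergent v (tau i)) -> convergent v u.
Proof.
move=> w_gt0 tau_high.
pose D u := \sum_i strip (P i) (M i) u * tau i.
have DB u u' : D u - D u' = D (u - u').
  by rewrite /D -sumrB; apply: eq_bigr => i _; rewrite stripB mulrBl.
have D_high d u : vanish_below w d u -> vanish_below w d.+1 (D u).
  move=> u0; apply: vanish_below_sum => i _ k lt.
  case: (leqP (wt w (M i)) d) => [le|gt].
    apply: (vanish_belowM (d := d - wt w (M i)) _ (tau_high i)).
      by apply: vanish_below_strip; rewrite subnKC.
    by rewrite addnS subnK.
  have strip0 : vanish_below w 0 (strip (P i) (M i) u) by [].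
  apply: (vanish_belowM strip0 (tau_high i)).
  by apply: leq_trans lt _; rewrite add0n ltnW.
pose U j := iter j (fun u => h + D u) 0.
have US j : U j.+1 = h + D (U j) by [].
have Ustep j : vanish_below w j (U j.+1 - U j).
  elim: j => [|j IH]; first by [].
  by rewrite !US opprD addrACA subrr add0r DB; apply: D_high; rewrite -US.
have Ustable i j k : (wt w k < i)%N -> (i <= j)%N -> U j k = U i k.
  move=> lt; elim: j => [|j IH]; first by rewrite leqn0 => /eqP->.
  rewrite leq_eqVlt => /orP[/eqP <- //|leij].
  rewrite -IH //; apply/eqP; rewrite -subr_eq0 -fps_coefB; apply/eqP/Ustep.
  exact: leq_trans lt _.
pose u : fps r K := Fps (fun k => U (wt w k).+1 k).
have uU j : vanish_below w j (u - U j).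
  by move=> k lt; rewrite fps_coefB (Ustable (wt w k).+1 j) //= subrr.
exists u => [|hc tauc].
  apply: fpsP => k; set j := (wt w k).+1.
  rewrite -[LHS](Ustable j j.+1) // US !fps_coefD; congr (_ + _).
  apply/eqP; rewrite eq_sym -subr_eq0 -fps_coefB DB.
  by apply/eqP/(D_high j); [exact: uU|rewrite ltnS /j].
have [s1 s1_gt0 [H hH]] := convergent_l1_small w_gt0 hc.
have [|s2 s2_gt0 Hs2] := @common_radius n
    (fun i s => l1_le w s (2^-1 / n.+1%:R * s ^+ wt w (M i)) (tau i)).
  move=> i; have [s0 [C [s0_gt0 tauC]]] := convergent_l1 w_gt0 (tauc i).
  apply: (l1_le_vanish s0_gt0 _ tauC (tau_high i)).
  by rewrite divr_gt0 ?invr_gt0.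
pose s := Order.min s1 s2.
have s_gt0 : 0 < s by rewrite lt_min s1_gt0.
have hs : l1_le w s H h by apply: hH; rewrite // ge_min lexx.
have taus i : l1_le w s (2^-1 / n.+1%:R * s ^+ wt w (M i)) (tau i).
  by apply: Hs2; rewrite // ge_min lexx orbT.
have H_ge0 := l1_le_ge0 hs.
have Us j : l1_le w s (2 * H) (U j).
  elim: j => [|j IH].
    by apply: l1_leW (l1_le0 _ _); rewrite mulr_ge0.
  rewrite US mulr_natl; apply: l1_leD; rewrite ?ltW //.
  apply: l1_leW (l1_le_sum (ltW s_gt0) (C := fun=> H / n.+1%:R) _); last first.
    move=> i; have := l1_leM (ltW s_gt0)
      (l1_le_strip (P i) (M i) s_gt0 IH) (taus i).
    apply: l1_leW.
    have sw : s ^+ wt w (M i) != 0 by rewrite expf_neq0 // gt_eqF.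
    have n0 : n.+1%:R != 0 :> R by rewrite pnatr_eq0.
    by rewrite le_eqVlt; apply/orP; left; apply/eqP; field; rewrite nat1r n0 sw.
  rewrite sumr_const card_ord -[leLHS]mulr_natr mulrAC ler_pdivrMr //.
  by rewrite ler_wpM2l // ler_nat.
apply: (l1_convergent s_gt0 (C := 2 * H)) => d.
pose j := (\max_(k : 'X_{1..r < d}) wt w k).+1.
apply: le_trans (Us j d); apply: ler_sum => k _.
rewrite (_ : u k = U j k) // (Ustable (wt w k).+1) //.
by rewrite ltnS (leq_bigmax k).
Qed.

End Norm.

Ltac converge :=
  lazymatch goal with
  | |- convergent _ (Xmon _) => exact: convergent_mon
  | |- convergent _ (fpsC _) => exact: convergentC
  | |- convergent _ (_%:R) => exact: convergent_nat
  | |- convergent _ (- _) => apply: convergentN; converge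
  | |- convergent _ (_ - _) => apply: convergentB; converge
  | |- convergent _ (_ + _) => apply: convergentD; converge
  | |- convergent _ (_ * _) => apply: convergentM; converge
  | |- convergent _ (_ ^+ _) => apply: convergentX; converge
  | _ => assumption
  end.

(** * Substitution of power series *)

Section Subst.
Variables (r s : nat) (K : comNzRingType) (xi : r.-tuple (fps s K)).
Implicit Types (f g : fps r K) (k : 'X_{1..r}) (m : 'X_{1..s}).

Definition subst_mon k : fps s K := \prod_(i < r) tnth xi i ^+ k i.

Lemma subst_monD k k' : subst_mon (k + k')%MM = subst_mon k * subst_mon k'.
Proof.
by rewrite -big_split; apply: eq_bigr => i _ /=; rewrite mnmDE exprD.
Qed.

Lemma subst_mon0 : subst_mon 0%MM = 1.
Proof. by rewrite /subst_mon big1 // => i _; rewrite mnm0E expr0. Qed.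

Lemma subst_mon1 i : subst_mon U_(i)%MM = tnth xi i.
Proof.
rewrite /subst_mon (bigD1 i) //= mnm1E eqxx expr1 big1 ?mulr1 // => j ne.
by rewrite mnm1E eq_sym (negbTE ne) expr0.
Qed.

Lemma vanish_below_subst_mon (w : 'I_s -> nat) (u : 'I_r -> nat) k :
  (forall i, vanish_below w (u i) (tnth xi i)) ->
  vanish_below w (wt u k) (subst_mon k).
Proof.
move=> xi0; rewrite /wt /subst_mon.
apply: (big_ind2 (fun d (f : fps s K) => vanish_below w d f)) => //.
  by move=> d f e g; apply: vanish_belowM.
by move=> i _; apply: vanish_belowX.
Qed.

Hypothesis xi0 : forall i, tnth xi i 0%MM = 0.

Lemma subst_mon_high k m : (mdeg m < mdeg k)%N -> subst_mon k m = 0.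
Proof.
rewrite -(wt_const1 k) -(wt_const1 m); apply: vanish_below_subst_mon => i m'.
by rewrite wt_const1 ltnS leqn0 mdeg_eq0 => /eqP ->.
Qed.

Lemma fps_subst_coef f m d : (mdeg m < d)%N ->
  fps_subst xi f m = \sum_(k : 'X_{1..r < d}) f k * subst_mon k m.
Proof.
move=> md; set d0 := (mdeg m).+1.
have le : (d0 <= d)%N by [].
pose phi (k : 'X_{1..r < d0}) : 'X_{1..r < d} :=
  BMultinom (leq_trans (bmdeg k) le).
have phi_inj : injective phi by move=> k k' /(congr1 val) /= /val_inj.
pose F k := f k * subst_mon k m.
have -> : fps_subst xi f m = \sum_(k : 'X_{1..r < d0}) F (phi k) by [].
rewrite -(big_imset (fun k : 'X_{1..r < d} => F k) (A := predT)) /=;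
  last by move=> k k' _ _ /phi_inj.
rewrite [RHS](bigID (mem (phi @: predT))) /= [X in _ + X]big1 ?addr0 //.
move=> k /negP nk; rewrite subst_mon_high ?mulr0 // ltnNge; apply/negP => le_k.
have kd : (mdeg k < d0)%N by [].
by case: nk; apply/imsetP; exists (BMultinom kd) => //; apply: val_inj.
Qed.

(** A finite part of [f(xi)] that suffices for the coefficients of degree less
    than [d], as [xi] has no constant terms. *)
Definition subst_trunc f d : fps s K :=
  \sum_(k : 'X_{1..r < d}) fpsC (f k) * subst_mon k.

Lemma subst_truncP f d :
  vanish_below (fun=> 1%N) d (fps_subst xi f - subst_trunc f d).
Proof.
move=> m; rewrite wt_const1 => md; rewrite fps_coefB (fps_subst_coef _ md).
rewrite fps_coef_sum -sumrB big1 // => k _.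
by rewrite fps_coefMC subrr.
Qed.

Fact fps_subst_is_zmod_morphism : zmod_morphism (fps_subst xi).
Proof.
move=> f g; apply: fpsP => m; rewrite fps_coefB /= -sumrB.
by apply: eq_bigr => k _; rewrite -mulrBl.
Qed.

Lemma fps_substXmon k : fps_subst xi (Xmon k) = subst_mon k.
Proof.
apply: fpsP => m; case: (ltnP (mdeg m) (mdeg k)) => [lt|le].
  rewrite subst_mon_high //= big1 // => k' _.
  case: eqP => [e|]; rewrite ?mul0r //.
  by have := bmdeg k'; rewrite e ltnS leqNgt lt.
have lt : (mdeg k < (mdeg m).+1)%N by [].
rewrite (fps_subst_coef _ (ltnSn _)) (bigD1 (BMultinom lt)) //=.
rewrite eqxx mulr1n mul1r big1 ?addr0 // => k' /eqP ne.
by case: eqP => [e|]; rewrite ?mul0r //; case: ne; apply: val_inj.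
Qed.

Lemma fps_subst1 : fps_subst xi 1 = 1.
Proof. by rewrite -Xmon0 fps_substXmon subst_mon0. Qed.

Lemma fps_substM f g : fps_subst xi (f * g) = fps_subst xi f * fps_subst xi g.
Proof.
apply: fpsP => m; set d := (mdeg m).+1.
have md : (mdeg m < d)%N by [].
set F := fps_subst xi f; set G := fps_subst xi g.
have -> : (F * G) m = (subst_trunc f d * subst_trunc g d) m.
  apply/eqP; rewrite -subr_eq0 -fps_coefB.
  have -> : F * G - subst_trunc f d * subst_trunc g d =
      (F - subst_trunc f d) * G + subst_trunc f d * (G - subst_trunc g d).
    by ring.
  suff high : vanish_below (fun=> 1%N) d ((F - subst_trunc f d) * G +
      subst_trunc f d * (G - subst_trunc g d)).
    by apply/eqP/high; rewrite wt_const1.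
  apply: vanish_belowD.
    rewrite -[d]addn0; apply: vanish_belowM => //; rewrite addn0.
    exact: subst_truncP.
  by rewrite -[d]add0n; apply: vanish_belowM => //; exact: subst_truncP.
rewrite (fps_subst_coef _ md).
pose H (c : 'X_{1..r < d, d}) :=
  f c.1 * g c.2 * subst_mon (c.1 + c.2)%MM m.
transitivity (\sum_c H c); last first.
  have -> : subst_trunc f d * subst_trunc g d = \sum_(c : 'X_{1..r < d, d})
      fpsC (f c.1) * subst_mon c.1 * (fpsC (g c.2) * subst_mon c.2).
    by rewrite /subst_trunc big_distrlr pair_bigA.
  rewrite fps_coef_sum; apply: eq_bigr => c _.
  by rewrite /H mulrACA -rmorphM fps_coefMC subst_monD.
transitivity (\sum_(k : 'X_{1..r < d}) \sum_(c : 'X_{1..r < d, d} |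
    k == (c.1 + c.2)%MM :> 'X_{1..r}) H c).
  apply: eq_bigr => k _; rewrite (fps_coefM _ _ (bmdeg k)) mulr_suml.
  by apply: eq_bigr => c /eqP e; rewrite /H -e.
rewrite (exchange_big_dep xpredT) //=; apply: eq_bigr => c _.
case: (ltnP (mdeg (c.1 + c.2)%MM) d) => [lt|le].
  by rewrite (big_pred1 (BMultinom lt)).
rewrite /H subst_mon_high // mulr0 big_pred0 // => k.
by apply/eqP => e; have := bmdeg k; rewrite e ltnNge le.
Qed.

Lemma fps_substB f g : fps_subst xi (f - g) = fps_subst xi f - fps_subst xi g.
Proof. exact: fps_subst_is_zmod_morphism. Qed.

Lemma fps_subst0 : fps_subst xi 0 = 0.
Proof. by rewrite -(subrr 0) fps_substB subrr. Qed.

Lemma fps_substN f : fps_subst xi (- f) = - fps_subst xi f.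
Proof. by rewrite -sub0r fps_substB fps_subst0 sub0r. Qed.

Lemma fps_substD f g : fps_subst xi (f + g) = fps_subst xi f + fps_subst xi g.
Proof. by rewrite -{1}[g]opprK fps_substB fps_substN opprK. Qed.

Lemma fps_substC c : fps_subst xi (fpsC c) = fpsC c.
Proof.
apply: fpsP => m.
have lt : (mdeg (0%MM : 'X_{1..r}) < (mdeg m).+1)%N by rewrite mdeg0.
rewrite (fps_subst_coef _ (ltnSn _)) (bigD1 (BMultinom lt)) //= subst_mon0.
rewrite fps_coef1 eqxx big1 ?addr0 => [|k ne].
  by case: eqP; rewrite (mulr1, mulr0).
case: eqP => [e|]; rewrite ?mul0r //; case/eqP: ne.
by apply: val_inj.
Qed.

Lemma fps_subst_sum I (t : seq I) (P : pred I) (F : I -> fps r K) :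
  fps_subst xi (\sum_(i <- t | P i) F i) =
  \sum_(i <- t | P i) fps_subst xi (F i).
Proof. exact: (big_morph _ fps_substD fps_subst0). Qed.

End Subst.

(** * Power series in one variable *)

Section OneVariable.
Variable K : comNzRingType.
Implicit Types (f g : fps 1 K) (d e : nat).

Notation t := (tvar K).

Definition tdeg d : 'X_{1..1} := (U_(ord0) *+ d)%MM.

Lemma mdeg_tdeg d : mdeg (tdeg d) = d.
Proof. by rewrite mdegMn mdeg1 mul1n. Qed.

Lemma tdeg0 : tdeg 0 = 0%MM.
Proof. by apply/eqP; rewrite -mdeg_eq0 mdeg_tdeg. Qed.

Lemma tdegE (k : 'X_{1..1}) : k = tdeg (mdeg k).
Proof.
apply/mnmP => i; rewrite mulmnE ord1 mnm1E eqxx mul1n mdegE.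
by rewrite big_ord1.
Qed.

Lemma tdegD d e : tdeg (d + e) = (tdeg d + tdeg e)%MM.
Proof. by apply/mnmP => i; rewrite mnmDE !mulmnE mulnDr. Qed.

Definition co f d := f (tdeg d).

Lemma coP f g : co f =1 co g -> f = g.
Proof. by move=> e; apply: fpsP => k; rewrite (tdegE k); apply: e. Qed.

Lemma tvarX d : t ^+ d = Xmon (tdeg d).
Proof. by rewrite /tvar fpsXE XmonX. Qed.

Lemma co_tvarX d e : co (t ^+ d) e = (e == d)%:R.
Proof.
rewrite tvarX /co /=; congr (_%:R); congr nat_of_bool.
by apply/eqP/eqP => [/(congr1 mdeg)|->//]; rewrite !mdeg_tdeg.
Qed.

Lemma co0 d : co 0 d = 0. Proof. exact: fps_coef0. Qed.
Lemma coD f g d : co (f + g) d = co f d + co g d. Proof. by []. Qed.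
Lemma coB f g d : co (f - g) d = co f d - co g d. Proof. by []. Qed.
Lemma co_sum I (s : seq I) (P : pred I) (F : I -> fps 1 K) d :
  co (\sum_(i <- s | P i) F i) d = \sum_(i <- s | P i) co (F i) d.
Proof. exact: fps_coef_sum. Qed.
Lemma coMC c f d : co (fpsC c * f) d = c * co f d.
Proof. exact: fps_coefMC. Qed.
Lemma coC c d : co (fpsC c) d = if d == 0%N then c else 0.
Proof. by rewrite /co /= -mdeg_eq0 mdeg_tdeg. Qed.

Lemma co_tshift d f e : co (t ^+ d * f) (d + e) = co f e.
Proof. by rewrite tvarX /co tdegD Xmon_mul_shift. Qed.

Definition tord_ge d f := forall e, (e < d)%N -> co f e = 0.

Lemma tord_geP d f : tord_ge d f <-> vanish_below (fun=> 1%N) d f.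
Proof.
split=> f0 k; first by rewrite wt_const1 (tdegE k) mdeg_tdeg => /f0.
by move=> lt; apply: f0; rewrite wt_const1 mdeg_tdeg.
Qed.

Lemma tord_geW d e f : (e <= d)%N -> tord_ge d f -> tord_ge e f.
Proof. by move=> le f0 k lt; apply/f0/(leq_trans lt). Qed.

Lemma tord_geD d f g : tord_ge d f -> tord_ge d g -> tord_ge d (f + g).
Proof. by move=> f0 g0 k lt; rewrite coD f0 ?g0 ?addr0. Qed.

Lemma tord_geB d f g : tord_ge d f -> tord_ge d g -> tord_ge d (f - g).
Proof. by move=> f0 g0 k lt; rewrite coB f0 ?g0 ?subr0. Qed.

Lemma tord_geM d e f g : tord_ge d f -> tord_ge e g -> tord_ge (d + e) (f * g).
Proof. rewrite !tord_geP; exact: vanish_belowM. Qed.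

Lemma tord_ge_tvarX d : tord_ge d (t ^+ d).
Proof. by move=> e lt; rewrite co_tvarX ltn_eqF. Qed.

Lemma tvar_dvd d f : tord_ge d f ->
  t ^+ d * strip xpredT (tdeg d) f = f.
Proof.
move=> f0; apply: coP => e; case: (ltnP e d) => [lt|le].
  rewrite f0 //; have strip0 : tord_ge 0 (strip xpredT (tdeg d) f) by [].
  by have H := tord_geM (@tord_ge_tvarX d) strip0; apply: H; rewrite addn0.
by rewrite -(subnKC le) co_tshift /co /= -tdegD.
Qed.

Lemma tord_ge_strip (P : pred 'X_{1..1}) d e f :
  tord_ge (d + e) f -> tord_ge e (strip P (tdeg d) f).
Proof.
move=> f0 k lt; rewrite /co /=; case: ifP => // _.
by rewrite -tdegD; apply: f0; rewrite ltn_add2l.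
Qed.

Lemma tshift_inj d f g : t ^+ d * f = t ^+ d * g -> f = g.
Proof.
by move=> e; apply: coP => i; rewrite -(co_tshift d f) e co_tshift.
Qed.

Lemma coM_neq0 f g d : co (f * g) d != 0 ->
  exists i j, [/\ d = (i + j)%N, co f i != 0 & co g j != 0].
Proof.
apply: contra_neqP => H; apply: fps_coefM_eq0 => a b ab.
have [->|fa] := eqVneq (f a) 0; first by rewrite mul0r.
have [->|gb] := eqVneq (g b) 0; first by rewrite mulr0.
case: H; exists (mdeg a), (mdeg b); rewrite /co -!tdegE fa gb; split=> //.
by rewrite -mdegD -ab mdeg_tdeg.
Qed.

Lemma coM0 f g : co (f * g) 0 = co f 0 * co g 0.
Proof.
have lt : (mdeg (tdeg 0) < 1)%N by rewrite mdeg_tdeg.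
have b0 (c : 'X_{1..1 < 1}) : (c : 'X_{1..1}) = tdeg 0.
  by rewrite (tdegE c); congr tdeg; have := bmdeg c; lia.
rewrite /co (fps_coefM _ _ lt) (big_pred1 (BMultinom lt, BMultinom lt)) //.
move=> [c c'] /=; rewrite !b0 -tdegD eqxx; apply/esym/eqP.
by congr (_, _); apply: val_inj; rewrite /= b0.
Qed.

Lemma coX0 f e : co (f ^+ e) 0 = co f 0 ^+ e.
Proof.
elim: e => [|e IH]; last by rewrite !exprS coM0 IH.
by rewrite !expr0 -(expr0 t) co_tvarX eqxx.
Qed.

End OneVariable.

(** * The numerical semigroup *)

Section Semigroup.
Local Open Scope nat_scope.

Lemma semigroupD l m n k k' : numerical_semigroup l m n k ->
  numerical_semigroup l m n k' -> numerical_semigroup l m n (k + k').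
Proof.
move=> [i [j [h ->]]] [i' [j' [h' ->]]]; exists (i + i'), (j + j'), (h + h').
by lia.
Qed.

Let le_mul x y z : x <= y -> x * z <= y * z.
Proof. by move=> le; rewrite leq_mul2r le orbT. Qed.

Let pos_mul c x : c <> 0 -> x <= c * x.
Proof. by move=> c0; rewrite leq_pmull //; lia. Qed.

Variables (a b : nat).
Notation l := (b + 2).
Notation m := (2 * a + 1).
Notation n := (a * b + b + 1).
Notation Gamma := (numerical_semigroup l m n).

(** The three binomial relations of the monomial curve:
    [y z = x ^ a.+1], [z ^ 2 = x y ^ b] and [y ^ b.+1 = x ^ a z]. *)
Lemma rel_yz : m + n = (a + 1) * l. Proof. by lia. Qed.
Lemma rel_zz : 2 * n = b * m + l. Proof. by lia. Qed.
Lemma rel_y : (b + 1) * m = a * l + n. Proof. by lia. Qed.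

(** An expression of [d + l] that involves no [x] involves [y] or [z], whose
    product with [z] is divisible by [x]. *)
Lemma shift_z d : Gamma (d + l) -> Gamma d \/ Gamma (d + n).
Proof.
move=> [[|i] [j [h e]]]; last by left; exists i, j, h; nia.
right; have rz := rel_zz; have ryz := rel_yz.
case: h e => [|h] e; last by exists 0, (j + b), h; nia.
case: j e => [|j] e; first by nia.
by exists a, j, 0; nia.
Qed.

(** If [d + l] and [d + m] are in the semigroup, then so is [d + k] for each of
    its elements [k > 0]. These [d] are the degrees of the monomial derivations
    [t ^ d * t d/dt] of the monomial curve; they form a monoid. *)
Definition shift d := Gamma (d + l) /\ Gamma (d + m).

Lemma shift0 : shift 0.
Proof. by split; [exists 1, 0, 0|exists 0, 1, 0]; lia. Qed.

Lemma shift_semigroup d k : shift d -> Gamma k -> 0 < k -> Gamma (d + k).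
Proof.
move=> [dl dm] [i [j [h ->]]] pos.
case: i pos => [|i] pos; last first.
  rewrite (_ : d + _ = (d + l) + (i * l + j * m + h * n)); last by lia.
  by apply: semigroupD => //; exists i, j, h.
case: j pos => [|j] pos; last first.
  rewrite (_ : d + _ = (d + m) + (0 * l + j * m + h * n)); last by lia.
  by apply: semigroupD => //; exists 0, j, h.
case: h pos => [|h] pos; first by lia.
case: (shift_z dl) => [dG|dn].
  by apply: semigroupD => //; exists 0, 0, h.+1.
rewrite (_ : d + _ = (d + n) + (0 * l + 0 * m + h * n)); last by lia.
by apply: semigroupD => //; exists 0, 0, h.
Qed.

Lemma shiftD d e : shift d -> shift e -> shift (d + e).
Proof.
move=> dS [el em]; split; rewrite -(addnA d);
  by apply: shift_semigroup => //; lia.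
Qed.

Hypotheses (a_ge2 : 2 <= a) (b_ge2 : 2 <= b).

Hypothesis lm_coprime : gcdn l m = 1.

(** As [n] is congruent to [- m] modulo [l], the class of a weight modulo [l]
    determines the class of the exponent of [y] minus that of [z]. *)
Lemma rep_mod i j h i' j' h' :
  i * l + j * m + h * n = i' * l + j' * m + h' * n ->
  exists c, j + h' = j' + h + c * l \/ j' + h = j + h' + c * l.
Proof.
move=> e; wlog le : i j h i' j' h' e / j' + h <= j + h'.
  move=> H; case: (leqP (j' + h) (j + h')) => [|/ltnW] le.
    by apply: H e le.
  by have [c [ec|ec]] := H _ _ _ _ _ _ (esym e) le; exists c; [right|left].
have dvd : l %| m * (j + h' - (j' + h)).
  have : i * l + j * m + h * n + (h + h') * m =
         i' * l + j' * m + h' * n + (h + h') * m by rewrite e.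
  rewrite (_ : i * l + _ + _ + _ =
    (i + h * (a + 1)) * l + (j + h') * m); last by lia.
  rewrite (_ : i' * l + _ + _ + _ =
    (i' + h' * (a + 1)) * l + (j' + h) * m); last by lia.
  move=> e2.
  have : (i + h * (a + 1)) * l + m * (j + h' - (j' + h)) =
         (i' + h' * (a + 1)) * l by nia.
  move=> e3; rewrite -(dvdn_addr _ (dvdn_mull (i + h * (a + 1)) (dvdnn l))) e3.
  exact: dvdn_mull.
rewrite Gauss_dvdr ?/coprime ?lm_coprime // in dvd.
by case/dvdnP: dvd => c ec; exists c; left; lia.
Qed.

(** Nontrivial relations between the generators only occur from the weight of
    [x ^ a.+1 = y z] on. *)
Lemma rep_unique i j h i' j' h' :
  i * l + j * m + h * n = i' * l + j' * m + h' * n ->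
  i * l + j * m + h * n < (a + 1) * l ->
  [/\ i = i', j = j' & h = h'].
Proof.
move=> e lt; have [c ec] := rep_mod e; have rz := rel_zz; have ry := rel_y.
have ryz := rel_yz.
have ab2 : 2 * b <= a * b by apply: le_mul.
have aa2 : a * 2 <= a * b by rewrite leq_mul2l b_ge2 orbT.
have bnd i0 j0 h0 : i0 * l + j0 * m + h0 * n < (a + 1) * l ->
    [/\ h0 <= 1, h0 = 1 -> j0 = 0 & j0 <= b].
  move=> lt0; split.
  - by rewrite leqNgt; apply/negP => /(@le_mul _ _ n); lia.
  - by move=> h01; apply/eqP/negP => /negP /eqP /(@pos_mul _ m); subst h0; lia.
  - by rewrite leqNgt; apply/negP => /(@le_mul _ _ m); lia.
have [h1 jz jb] := bnd _ _ _ lt.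
have [h1' jz' jb'] : [/\ h' <= 1, h' = 1 -> j' = 0 & j' <= b].
  by apply: (bnd i'); rewrite -e.
have c0 : c = 0.
  by case: (eqVneq c 0) => // /eqP /(@pos_mul _ l); lia.
subst c; have [hh|hh] : h = h' \/ h <> h' by lia.
  have jj : j = j' by lia.
  by split=> //; nia.
have [h0|h0] : h = 0 \/ h = 1 by lia.
  have : h' = 1 by lia.
  by lia.
have : h' = 0 by lia.
by lia.
Qed.

(** The monomials [x ^ i y ^ j z ^ h] not divisible by any of [y z],
    [y ^ b.+1], [z ^ 2]; their weights are distinct. *)
Definition standard j h := h = 0 /\ j <= b \/ h = 1 /\ j = 0.

Lemma standard_unique i j h i' j' h' : standard j h -> standard j' h' ->
  i * l + j * m + h * n = i' * l + j' * m + h' * n ->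
  [/\ i = i', j = j' & h = h'].
Proof.
move=> st st' e; have [c ec] := rep_mod e.
have c0 : c = 0.
  by case: st st' => [[-> ?]|[-> ->]] [[-> ?]|[-> ->]] in ec *; nia.
have hj : h = h' /\ j = j'.
  by case: st st' => [[-> ?]|[-> ->]] [[-> ?]|[-> ->]] in ec *; lia.
by case: hj => eh ej; subst h' j'; split=> //; nia.
Qed.

(** The weights [0, m, .., b m, n] of the standard monomials without [x]
    represent all classes modulo [l], and [b m] is the largest one. So [b m - l]
    is the largest gap. *)
Lemma frobenius_notin : ~ Gamma (b * m - l).
Proof.
move=> [i [j [h e]]]; have rz := rel_zz.
have e' : (i + 1) * l + j * m + h * n = 0 * l + b * m + 0 * n by nia.
have [c ec] := rep_mod e'.
have h1 : h <= 1.
  rewrite leqNgt; apply/negP => /(@le_mul _ _ n).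
  by rewrite rz; move: (i * l) (j * m) (h * n) (b * m) e => *; lia.
have [h0|h0] : h = 0 \/ h = 1 by lia.
  subst h; have [c0|c0] : c = 0 \/ 0 < c by lia.
    by subst c; have : j = b by [lia]; nia.
  by nia.
subst h; have [c0|c0] : c = 0 \/ 0 < c by lia.
  by subst c; have : j = b + 1 by [lia]; nia.
by nia.
Qed.

Lemma above_frobenius k : b * m - l < k -> Gamma k.
Proof.
move=> lt; have rz := rel_zz; have ryz := rel_yz.
have [j ltj dj] : exists2 j, j < l & j * m = k %[mod l].
  have m0 : 0 < m by lia.
  have [[u u'] /= uu'] : exists u, u.1 * m - u.2 * l = 1.
    by apply/(coprimeP l m0); rewrite /coprime gcdnC lm_coprime.
  exists ((k * u) %% l); first by rewrite ltn_mod; lia.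
  rewrite modnMml (_ : k * u * m = k * u' * l + k) ?modnMDl //; nia.
have wrap j' : j' * m = k %[mod l] -> j' * m <= k ->
    exists i, k = i * l + j' * m.
  move=> /esym/eqP ej le; move: ej; rewrite eqn_mod_dvd // => /dvdnP [c ec].
  by exists c; lia.
have [le|gt] := leqP (j * m) k.
  by have [i ->] := wrap j dj le; exists i, j, 0; lia.
have big : k + l <= j * m.
  move/eqP: dj; rewrite eqn_mod_dvd ?(ltnW gt) // => /dvdnP [c ec].
  by have : 0 < c; nia.
have ej : j = b + 1 by nia.
have rb := rel_y; subst j; have [le|gt'] := leqP n k.
  move/eqP: dj; rewrite rel_y modnMDl eq_sym eqn_mod_dvd // => /dvdnP [c ec].
  by exists c, 0, 1; lia.
move/eqP: dj; rewrite rel_y modnMDl eqn_mod_dvd ?(ltnW gt') //.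
move=> /dvdnP [c ec].
have : 0 < c by nia.
by nia.
Qed.

Lemma conductorE gamma : is_conductor Gamma gamma -> gamma + l = b * m + 1.
Proof.
move=> [above least]; have bm : l <= b * m by nia.
have le : gamma <= (b * m - l).+1 by apply: least => k; apply: above_frobenius.
have [lt|gt] := leqP gamma (b * m - l); last by lia.
by case: frobenius_notin; apply: above.
Qed.

(** The quotient [x ^ i z / y] is not a monomial in [x], [y / x], [z / x] if the
    weight of [y] exceeds that of [x ^ i.+2]: modulo [l] such a monomial would
    have to contain [(y / x) ^ b] or [(z / x) ^ 2], which are too large. *)
Lemma xz_over_y_notin i : (i + 2) * l < m ->
  ~ numerical_semigroup l (m - l) (n - l) (n + i * l - m).
Proof.
move=> large [i' [j [h e]]].
have rz := rel_zz; have ry := rel_y.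
have ll : l < m by nia.
have il : i + 2 <= a.
  by rewrite leqNgt; apply/negP; rewrite -addn1 => /(@le_mul _ _ l); lia.
have il2 := le_mul l il; have ryz := rel_yz.
have ab2 : 2 * b <= a * b by apply: le_mul.
have aa2 : a * 2 <= a * b by rewrite leq_mul2l b_ge2 orbT.
have h2 : h < 2.
  rewrite ltnNge; apply/negP => /(@le_mul _ _ (n - l)) h2.
  move: (i' * l) (j * (m - l)) (h * (n - l)) e h2 => X Y Z e h2; lia.
have jb : j < b.
  rewrite ltnNge; apply/negP => /(@le_mul _ _ (m - l)) jb.
  have bml : b * (m - l) + b * l = b * m by rewrite -mulnDr subnK // ltnW.
  have : 2 * b + 2 + 2 * i <= m by lia.
  move=> /(@le_mul _ _ l).
  move: (i' * l) (h * (n - l)) (b * (m - l)) (j * (m - l)) e jb bml.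
  by move=> X Y Z T e jb bml; lia.
have jml : j * (m - l) + j * l = j * m by rewrite -mulnDr subnK // ltnW.
have hnl : h * (n - l) + h * l = h * n by rewrite -mulnDr subnK; lia.
have e' : (i + j + h) * l + 0 * m + 1 * n = i' * l + (j + 1) * m + h * n.
  rewrite !mulnDl; move: (i' * l) (h * (n - l)) (j * (m - l)) e jml hnl.
  by move=> X Y Z e jml hnl; lia.
have [c ec] := rep_mod e'.
have [c0|/eqP /(@pos_mul _ l)] := eqVneq c 0; last by lia.
by subst c; lia.
Qed.

End Semigroup.

(** * Space curves near a monomial curve *)

Notation ix := (ord0 : 'I_3).
Notation iy := (lift ord0 ord0 : 'I_3).
Notation iz := (lift ord0 (lift ord0 ord0) : 'I_3).

Lemma ord3P (P : 'I_3 -> Prop) : P ix -> P iy -> P iz -> forall i, P i.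
Proof.
move=> P0 P1 P2 i; case: (unliftP ord0 i) => [j|] -> //.
case: (unliftP ord0 j) => [j'|] -> //.
by rewrite (ord1 j').
Qed.

Definition w3 (l m n : nat) : 'I_3 -> nat := fun i => nth 0%N [:: l; m; n] i.

Lemma wt_w3 l m n k : wt (w3 l m n) k = (k ix * l + k iy * m + k iz * n)%N.
Proof. by rewrite /wt !big_ord_recl big_ord0 /w3 /=; lia. Qed.

Definition mon3 i j h : 'X_{1..3} :=
  [multinom nth 0%N [:: i; j; h] x | x < 3].

Lemma mon3E i j h :
  [/\ mon3 i j h ix = i, mon3 i j h iy = j & mon3 i j h iz = h].
Proof. by rewrite /mon3 !mnmE. Qed.

Lemma mon3_eta (k : 'X_{1..3}) : k = mon3 (k ix) (k iy) (k iz).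
Proof. by apply/mnmP; apply: ord3P; rewrite /mon3 mnmE. Qed.

Lemma mon3_le i j h k :
  (mon3 i j h <= k)%MM = [&& i <= k ix, j <= k iy & h <= k iz]%N.
Proof.
apply/mnm_lepP/and3P => [le|[lex ley lez]].
  by have := (le ix, le iy, le iz); rewrite /mon3 !mnmE => -[[]].
by apply: ord3P; rewrite /mon3 mnmE.
Qed.

Lemma wt_mon3 l m n i j h :
  wt (w3 l m n) (mon3 i j h) = (i * l + j * m + h * n)%N.
Proof. by rewrite wt_w3; case: (mon3E i j h) => -> -> ->. Qed.

Lemma semigroup_wt l m n k : numerical_semigroup l m n (wt (w3 l m n) k).
Proof. by rewrite wt_w3; exists (k ix), (k iy), (k iz). Qed.

Lemma sum_by_level (V : zmodType) (I : finType) (W : I -> nat) (F : I -> V) d :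
  \sum_(i | (W i < d)%N) F i = \sum_(w < d) \sum_(i | W i == w) F i.
Proof.
elim: d => [|d IH]; first by rewrite big_ord0 big_pred0.
rewrite big_ord_recr -IH /= (bigID (fun i => W i == d)) /= addrC.
by congr (_ + _); apply: eq_bigl => i; lia.
Qed.

Section Curve.
Variables (K : comNzRingType) (l m n delta : nat) (y z : fps 1 K).
Hypotheses (l_gt0 : (0 < l)%N) (m_gt0 : (0 < m)%N) (n_gt0 : (0 < n)%N).
Hypothesis delta_gt0 : (0 < delta)%N.

Notation t := (tvar K).
Notation W := (wt (w3 l m n)).

Hypothesis yE : tord_ge (m + delta) (y - t ^+ m).
Hypothesis zE : tord_ge (n + delta) (z - t ^+ n).

Definition curve : 3.-tuple (fps 1 K) := [tuple t ^+ l; y; z].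

Notation mon := (subst_mon curve).
Notation ev := (fps_subst curve).

Lemma mon_mon3 i j h : mon (mon3 i j h) = t ^+ (l * i) * y ^+ j * z ^+ h.
Proof.
rewrite /subst_mon !big_ord_recl big_ord0 mulr1 mulrA exprM.
by case: (mon3E i j h) => -> -> ->; rewrite !(tnth_nth 0).
Qed.

Lemma w3_gt0 i : (0 < w3 l m n i)%N.
Proof. by elim/ord3P: i. Qed.

(** The error has relative order [delta], which is what makes this
    multiplicative in [f] and [d]. *)
Definition near d (f : fps 1 K) := tord_ge (d + delta) (f - t ^+ d).

Lemma near_tvarX d : near d (t ^+ d).
Proof. by move=> e _; rewrite subrr co0. Qed.

Lemma near_ge d f : near d f -> tord_ge d f.
Proof.
move=> fd; rewrite -(subrK (t ^+ d) f); apply: tord_geD.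
  by apply: tord_geW fd; rewrite leq_addr.
exact: tord_ge_tvarX.
Qed.

Lemma nearM d e f g : near d f -> near e g -> near (d + e) (f * g).
Proof.
move=> fd ge; rewrite /near.
have -> : f * g - t ^+ (d + e) = (f - t ^+ d) * g + t ^+ d * (g - t ^+ e).
  by rewrite exprD; ring.
apply: tord_geD.
  by rewrite addnAC; apply: tord_geM => //; apply: near_ge.
by rewrite -addnA; apply: tord_geM => //; apply: tord_ge_tvarX.
Qed.

Lemma nearX d e f : near d f -> near (d * e) (f ^+ e).
Proof.
move=> fd; elim: e => [|e IH].
  by rewrite muln0 expr0; exact: (@near_tvarX 0).
by rewrite exprS mulnS; apply: nearM.
Qed.

Lemma near_coef d f e : near d f -> (e < d + delta)%N -> co f e = (e == d)%:R.
Proof.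
by move=> fd /fd; rewrite coB co_tvarX => /eqP; rewrite subr_eq0 => /eqP.
Qed.

Lemma near_mon k : near (W k) (mon k).
Proof.
rewrite (mon3_eta k) wt_mon3 mon_mon3 [(_ * l)%N]mulnC [(_ * m)%N]mulnC
  [(_ * n)%N]mulnC.
by apply: nearM; [apply: nearM; [exact: near_tvarX|]|]; apply: nearX.
Qed.

Lemma co_mon_low k e : (e < W k)%N -> co (mon k) e = 0.
Proof. exact: (near_ge (@near_mon k)). Qed.

Lemma co_mon_lead k : co (mon k) (W k) = 1.
Proof.
by rewrite (near_coef (@near_mon k)) ?eqxx // -{1}[W k]addn0 ltn_add2l.
Qed.

Lemma curve0 i : tnth curve i 0%MM = 0.
Proof.
rewrite -subst_mon1 (tdegE 0%MM) mdeg0; apply: (co_mon_low (e := 0)).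
by apply: leq_trans (mdeg_le_wt _ w3_gt0); rewrite mdeg1.
Qed.

Lemma co_ev f e d : (e < d)%N ->
  co (ev f) e = \sum_(k : 'X_{1..3 < d}) f k * co (mon k) e.
Proof.
by move=> lt; apply: (fps_subst_coef curve0); rewrite mdeg_tdeg.
Qed.

Lemma co_ev_supp f e : co (ev f) e != 0 ->
  exists k, f k != 0 /\ co (mon k) e != 0.
Proof.
rewrite (co_ev f (ltnSn e)); apply: contra_neqP => H.
apply: big1 => k _; have [->|fk] := eqVneq (f k) 0; first by rewrite mul0r.
have [->|mk] := eqVneq (co (mon k) e) 0; first by rewrite mulr0.
by case: H; exists k.
Qed.

(** ** Values of analytic functions *)

Section Values.
Variables (d1 gamma : nat).
Hypothesis unique : forall k k', W k = W k' -> (W k < d1)%N -> k = k'.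
Hypothesis gamma_le : (gamma <= d1 + delta)%N.

Definition drop_low w0 (f : fps 3 K) : fps 3 K :=
  Fps (fun k => if (w0 <= W k)%N then f k else 0).

(** Coefficients of [f] at low weight contribute nothing below [gamma] as soon
    as they do not contribute to the leading terms.  Indeed monomials of the
    same weight [w >= d1] have the same image [t ^+ w] up to order
    [d1 + delta], and for [w < d1] there is at most one of them. *)
Lemma ev_drop_low f w0 e : tord_ge w0 (ev f) -> (w0 <= gamma)%N ->
  (e < gamma)%N -> co (ev f) e = co (ev (drop_low w0 f)) e.
Proof.
move=> f0 w0le elt; set D := gamma.
pose S w := \sum_(k : 'X_{1..3 < D} | W k == w) f k.
have block w c : S w = 0 -> (c < gamma)%N ->
    \sum_(k : 'X_{1..3 < D} | W k == w) f k * co (mon k) c = 0.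
  move=> Sw clt; case: (ltnP w d1) => [lt|ge].
    case: (pickP (fun k : 'X_{1..3 < D} => W k == w)) => [k0 /eqP k0w|no];
      last by rewrite big_pred0.
    have only (k : 'X_{1..3 < D}) : (W k == w) = (k == k0).
      apply/eqP/eqP => [kw|->] //; apply/val_inj/unique.
        by rewrite kw -k0w.
      by rewrite kw.
    move: Sw; rewrite /S !(eq_bigl _ _ only) !big_pred1_eq => ->.
    by rewrite mul0r.
  transitivity (S w * (c == w)%:R); last by rewrite Sw mul0r.
  rewrite /S mulr_suml; apply: eq_bigr => k /eqP kw.
  by rewrite (near_coef (@near_mon k)) kw //; lia.
(* By induction, only monomials of weight [w] contribute at order [w]. *)
have S0 w : (w < w0)%N -> S w = 0.
  elim/ltn_ind: w => w IH lt; have wD : (w < D)%N by apply: leq_trans lt _.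
  have := f0 w lt; rewrite (co_ev _ wD).
  rewrite (bigID (fun k : 'X_{1..3 < D} => (W k < w)%N)) /= sum_by_level big1.
    rewrite add0r (bigID (fun k : 'X_{1..3 < D} => W k == w)) /=.
    rewrite [X in _ + X]big1 ?addr0 => [|k /andP[ge ne]]; last first.
      by rewrite co_mon_low ?mulr0 //; lia.
    move=> <-; apply: eq_big => k; first by lia.
    by move/eqP=> kw; rewrite -[X in co _ X]kw co_mon_lead mulr1.
  move=> w' _; apply: block => //; apply: IH => //.
  exact: ltn_trans (ltn_ord w') lt.
apply/eqP; rewrite -subr_eq0 !(co_ev _ elt) -sumrB; apply/eqP.
rewrite (bigID (fun k : 'X_{1..3 < D} => (W k < w0)%N)) /=.
rewrite [X in _ + X]big1 ?addr0 => [|k]; last first.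
  by rewrite -leqNgt => ->; rewrite subrr.
rewrite (eq_bigr (fun k : 'X_{1..3 < D} => f k * co (mon k) e)); last first.
  by move=> k; rewrite ltnNge => /negbTE->; rewrite mul0r subr0.
by rewrite sum_by_level big1 // => w _; apply: block => //; apply: S0.
Qed.

Lemma value_in_semigroup f w : tord_ge w (ev f) -> co (ev f) w != 0 ->
  (w < gamma)%N -> numerical_semigroup l m n w.
Proof.
move=> f0 nz lt; move: nz; rewrite (ev_drop_low f0 (ltnW lt) lt).
move=> /co_ev_supp [k [/=]]; case: leqP => [le _ mk|]; last by rewrite eqxx.
suff -> : w = W k by apply: semigroup_wt.
apply/eqP; rewrite eqn_leq le leqNgt; apply/negP => /co_mon_low mk0.
by rewrite mk0 eqxx in mk.
Qed.

End Values.

(** The leading terms of the images of monomials of distinct weights cannot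
    cancel. *)
Lemma ev_independent (P : pred 'X_{1..3}) (f : fps 3 K) :
  (forall k k', P k -> P k' -> W k = W k' -> k = k') ->
  (forall k, ~~ P k -> f k = 0) -> ev f = 0 -> f = 0.
Proof.
move=> Pinj fP f0; suff H w k : W k = w -> f k = 0.
  by apply: fpsP => k; rewrite fps_coef0 (H _ k erefl).
elim/ltn_ind: w k => w IH k kw; have [Pk|/fP//] := boolP (P k).
have kd : (mdeg k < w.+1)%N by rewrite ltnS -kw mdeg_le_wt //; apply: w3_gt0.
have := co0 K w; rewrite -f0 (co_ev f (ltnSn w)) (bigD1 (BMultinom kd)) //=.
rewrite (_ : co (mon k) w = 1) ?mulr1; last by rewrite -kw co_mon_lead.
rewrite big1 ?addr0 // => k' /eqP ne.
have [Pk'|/fP->] := boolP (P k'); last by rewrite mul0r.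
have [lt|lt|e] := ltngtP (W k') w.
- by rewrite (IH _ lt k') ?mul0r.
- by rewrite co_mon_low ?mulr0.
by case: ne; apply/val_inj/Pinj => //; rewrite e.
Qed.

End Curve.

(** * Series beyond the conductor *)

Section Representation.
Variables (R : realType) (K : fieldType) (v : K -> R).
Hypothesis v_abs : absolute_value v.
Variables (l m n delta : nat) (y z : fps 1 K).
Hypotheses (l_gt0 : (0 < l)%N) (m_gt0 : (0 < m)%N) (n_gt0 : (0 < n)%N).
Hypothesis delta_gt0 : (0 < delta)%N.
Notation t := (tvar K).
Notation W := (wt (w3 l m n)).
Hypothesis yE : tord_ge (m + delta) (y - t ^+ m).
Hypothesis zE : tord_ge (n + delta) (z - t ^+ n).
Hypotheses (yc : convergent v y) (zc : convergent v z).

Notation C := (curve l y z).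
Notation ev := (fps_subst C).
Let C0 := curve0 l_gt0 m_gt0 n_gt0 yE zE.

Lemma convergent_tvarX d : convergent v (t ^+ d).
Proof. by rewrite tvarX; apply: convergent_mon. Qed.

Lemma convergent_subst_mon k : convergent v (subst_mon C k).
Proof.
by apply: convergent_prod => // i _; apply: convergentX => //;
  elim/ord3P: i; rewrite (tnth_nth 0) //=; apply: convergent_tvarX.
Qed.

(** A series in [x] alone, since [x] pulls back to [t ^ l]. *)
Definition lift_x d (u : fps 1 K) : fps 3 K :=
  Fps (fun k => if (k iy == 0%N) && (k iz == 0%N)
                then co u (d + k ix * l) else 0).

Lemma ev_lift_x d u :
  ev (lift_x d u) = strip (fun k => l %| mdeg k)%N (tdeg d) u.
Proof.
apply: coP => e; rewrite (co_ev l_gt0 m_gt0 n_gt0 yE zE _ (ltnSn e)).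
have xpow (k : 'X_{1..3}) : k iy = 0%N -> k iz = 0%N ->
    subst_mon C k = t ^+ (l * k ix).
  by move=> ky kz; rewrite (mon3_eta k) ky kz mon_mon3 !expr0 !mulr1;
     case: (mon3E (k ix) 0 0) => ->.
rewrite {2}/co /= mdeg_tdeg -tdegD -/(co u _); case: dvdnP => [[i ei]|nd].
  have kd : (mdeg (mon3 i 0 0) < e.+1)%N.
    rewrite mdegE !big_ord_recl big_ord0.
    by case: (mon3E i 0 0) => -> -> ->; nia.
  have [kx ky kz] := mon3E i 0 0.
  rewrite (bigD1 (BMultinom kd)) //= ky kz kx /= xpow // kx co_tvarX.
  rewrite (_ : e == l * i)%N ?mulr1 -?ei; last by rewrite mulnC -ei.
  rewrite big1 ?addr0 // => k ne.
  case: ifP => [/andP[/eqP k1 /eqP k2]|]; last by rewrite mul0r.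
  rewrite xpow // co_tvarX; case: eqP => [e2|]; last by rewrite mulr0.
  case/eqP: ne; apply: val_inj => /=.
  rewrite (mon3_eta k) k1 k2; congr mon3.
  by apply/eqP; rewrite -(eqn_pmul2r l_gt0) mulnC -e2; apply/eqP.
apply: big1 => k _ /=.
case: ifP => [/andP[/eqP k1 /eqP k2]|]; last by rewrite mul0r.
rewrite xpow // co_tvarX; case: eqP => [e2|]; last by rewrite mulr0.
by case: nd; exists ((k : 'X_{1..3}) ix); rewrite mulnC.
Qed.

Lemma convergent_lift_x d u : convergent v u -> convergent v (lift_x d u).
Proof.
move=> [rho [B [rho0 uB]]]; exists (rho ^+ l), (B / rho ^+ d).
split=> [|k]; first by rewrite exprn_gt0.
have B0 : 0 <= B.
  apply: le_trans (uB 0%MM).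
  by rewrite mulr_ge0 ?(abs_ge0 v_abs) ?exprn_ge0 ?ltW.
rewrite /=; case: ifP => [/andP[/eqP k1 /eqP k2]|_]; last first.
  by rewrite (abs0 v_abs) mul0r divr_ge0 // exprn_ge0 ?ltW.
have -> : mdeg k = k ix.
  by rewrite mdegE !big_ord_recl big_ord0 k1 k2; lia.
rewrite ler_pdivlMr ?exprn_gt0 // -mulrA -exprM -exprD.
have := uB (tdeg (d + k ix * l)); rewrite mdeg_tdeg.
by rewrite addnC [(l * _)%N]mulnC.
Qed.

(** [t ^ c K{t}] is a module over [K{t ^ l}] with basis [t ^ (c + j)], [j < l].
    If [c + N] is contained in the semigroup, then replacing [t ^ (c + j)] by a
    monomial in the coordinates of the same order preserves bases, by
    successive approximation.  The representing series has no monomials of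
    weight below [c]. *)
Lemma representation c h :
  (forall k, (c <= k)%N -> numerical_semigroup l m n k) ->
  convergent v h -> tord_ge c h ->
  exists f, [/\ convergent v f, ev f = h & vanish_below (w3 l m n) c f].
Proof.
move=> above hc h0.
have /choice [kap kapE] : forall j : 'I_l, exists k, W k = (c + j)%N.
  move=> j; have [i [j' [h' ->]]] := above _ (leq_addr j c).
  by exists (mon3 i j' h'); rewrite wt_mon3.
pose tau (j : 'I_l) := t ^+ (c + j) - subst_mon C (kap j).
have tau0 (j : 'I_l) : tord_ge (c + j).+1 (tau j).
  move=> e lt; rewrite /tau -opprB /co fps_coefN -/(co _ e).
  have nr := @near_mon _ _ _ _ _ _ _ yE zE (kap j).
  rewrite -(kapE j) nr ?oppr0 //.
  by apply: leq_trans lt _; rewrite -kapE -addn1 leq_add2l.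
have [|u uE uc] := @division _ _ _ v_abs 1 (fun=> 1%N) l (fun j => tdeg (c + j))
  (fun j k => l %| mdeg k)%N tau h (fun=> isT).
  by move=> j; rewrite wt_const1 mdeg_tdeg; apply/tord_geP.
have {}uc : convergent v u.
  apply: uc => // j; apply: convergentB => //; first exact: convergent_tvarX.
  exact: convergent_subst_mon.
pose A (j : 'I_l) := strip (fun k => l %| mdeg k)%N (tdeg (c + j)) u.
have u0 : tord_ge c u.
  rewrite uE; apply: tord_geD => // e lt; rewrite co_sum big1 // => j _.
  have A0 : tord_ge 0 (A j) by [].
  by have := tord_geM A0 (tau0 j); apply; lia.
have uA : u = \sum_j A j * t ^+ (c + j).
  apply: coP => e; rewrite co_sum; case: (ltnP e c) => [lt|le].
    rewrite u0 // big1 // => j _; have A0 : tord_ge 0 (A j) by [].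
    by have := tord_geM A0 (@tord_ge_tvarX _ (c + j)); apply; lia.
  have jl : ((e - c) %% l < l)%N by rewrite ltn_mod.
  have term (j : 'I_l) : co (A j * t ^+ (c + j)) e =
      if (c + j <= e)%N && (l %| e - (c + j))%N then co u e else 0.
    case: leqP => [lej|ltj].
      rewrite mulrC -{1}(subnKC lej) co_tshift.
      by rewrite /co /= mdeg_tdeg -tdegD subnKC.
    have A0 : tord_ge 0 (A j) by [].
    by have := tord_geM A0 (@tord_ge_tvarX _ (c + j)); apply; lia.
  rewrite (bigD1 (Ordinal jl)) // term big1 ?addr0 => [|j ne].
    have ee := divn_eq (e - c) l.
    suff -> : (c + Ordinal jl <= e)%N && (l %| e - (c + Ordinal jl))%N.
      by rewrite /= addr0.
    have := leq_mod (e - c) l; rewrite /=.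
    move: ((e - c) %/ l)%N ((e - c) %% l)%N ee => Q r ee ler.
    by apply/andP; split; [lia|apply/dvdnP; exists Q; lia].
  rewrite term; case: ifP => // /andP[le1 /dvdnP[i ei]]; case/eqP: ne.
  apply: val_inj => /=; have -> : (e - c = i * l + j)%N by lia.
  by rewrite modnMDl modn_small.
have hA : h = \sum_j A j * subst_mon C (kap j).
  have -> : h = u - \sum_j A j * tau j by rewrite {1}uE addrK.
  rewrite {1}uA -sumrB; apply: eq_bigr => j _.
  by rewrite -mulrBr /tau opprB addrC subrK.
exists (\sum_(j < l) lift_x (c + j) u * Xmon (kap j)); split.
- apply: convergent_sum => // j _; apply: convergentM => //.
    exact: convergent_lift_x.
  exact: convergent_mon.
- rewrite fps_subst_sum hA; apply: eq_bigr => j _.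
  by rewrite (fps_substM C0) ev_lift_x (fps_substXmon C0).
apply: vanish_below_sum => j _.
have L0 : vanish_below (w3 l m n) 0 (lift_x (c + j) u) by [].
apply: vanish_belowW (vanish_belowM L0 (@vanish_below_Xmon _ _ _ (kap j))).
by rewrite kapE leq_addr.
Qed.

End Representation.

(** * Set-theoretic complete intersections *)

Section Determinantal.
Variables (R : realType) (K : fieldType) (v : K -> R).
Hypothesis v_abs : absolute_value v.
Variables (xi : 3.-tuple (fps 1 K)) (d : nat).
Hypothesis xi0 : forall i, tnth xi i 0%MM = 0.
Hypothesis xE : tnth xi ix = tvar K ^+ d.

Notation ev := (fps_subst xi).
Notation x := (Xmon (mon3 1 0 0) : fps 3 K).
Notation y := (Xmon (mon3 0 1 0) : fps 3 K).
Notation z := (Xmon (mon3 0 0 1) : fps 3 K).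

Variables alpha beta : fps 3 K.
Hypotheses (alphac : convergent v alpha) (betac : convergent v beta).
Hypothesis alphaE : ev (alpha * x) = ev (y * z).
Hypothesis betaE : ev (beta * x) = ev (z * z).

Definition minors : 3.-tuple (fps 3 K) :=
  [tuple y * z - alpha * x; beta * y - z * alpha; z * z - beta * x].

(** In the matrix [(alpha, beta, z; y, z, x)] the last two columns form a
    symmetric matrix [S]. Put [F0 = det S] and [F1 = w^T adj(S) w], where
    [w = (alpha, y)] is the first column. Then the minors [g1 = y z - alpha x]
    and [g2 = beta y - alpha z] satisfy [g1 ^ 2 = x F1 - y ^ 2 F0] and
    [g2 ^ 2 = beta F1 - alpha ^ 2 F0], so that the ideal of minors has the same
    radical as [(F0, F1)]. *)
Lemma determinantal_ci :
  (forall h, convergent v h -> ev h = 0 -> generated_ideal v minors h) ->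
  set_theoretic_ci_space_curve v xi.
Proof.
move=> gen.
have xc : convergent v x := convergent_mon v_abs _.
have yc : convergent v y := convergent_mon v_abs _.
have zc : convergent v z := convergent_mon v_abs _.
have evx : ev x = tvar K ^+ d.
  rewrite (fps_substXmon xi0) -xE -subst_mon1; congr subst_mon.
  by rewrite [RHS]mon3_eta !mnm1E.
pose F0 := beta * x - z * z.
pose F1 := alpha * alpha * x - 2%:R * alpha * y * z + y * y * beta.
have F0E : ev F0 = 0 by rewrite /F0 fps_substB betaE subrr.
have F1E : ev F1 = 0.
  apply: (@tshift_inj _ d); rewrite -evx -(fps_substM xi0).
  have -> : x * F1 = (y * z - alpha * x) * (y * z - alpha * x) + y * y * F0.
    by rewrite /F1 /F0; ring.
  rewrite fps_substD !(fps_substM xi0) F0E fps_substB alphaE subrr.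
  by rewrite mul0r !mulr0 addr0.
have F0c : convergent v F0 by rewrite /F0; converge.
have F1c : convergent v F1 by rewrite /F1; converge.
exists [tuple F0; F1].
  case=> [[|[|//]] lt]; rewrite (tnth_nth 0) //=.
apply/seteqP; split=> h [hc [k hk]]; split=> //.
  have [hkc hk0] := hk; have [c cc hkE] := gen _ hkc hk0.
  exists (k * 3)%N; rewrite exprM.
  move: hkE; rewrite !big_ord_recl big_ord0 addr0 !(tnth_nth 0) /=.
  move: (c _) (cc ord0) (c _) (cc iy) (c _) (cc iz) => A1 A1c A2 A2c A3 A3c.
  set p := A1 * _; set q := A2 * _ => hkE.
  pose r := - A3.
  (* [h ^ k = p + q + r F0], where [p ^ 2] and [q ^ 2] are multiples of the
     squares of minors; each term of the cube contains [p ^ 2], [q ^ 2] or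
     [r F0]. *)
  pose c1 := A1 * A1 * x * (p + 3%:R * q) + A2 * A2 * beta * (q + 3%:R * p).
  pose c0 := r * (3%:R * (p + q) * (p + q) + 3%:R * (p + q) * (r * F0) +
    r * F0 * (r * F0)) - A1 * A1 * (y * y) * (p + 3%:R * q)
    - A2 * A2 * (alpha * alpha) * (q + 3%:R * p).
  have [pc qc rc] : [/\ convergent v p, convergent v q & convergent v r].
    by rewrite /p /q /r; split; converge.
  have c1c : convergent v c1.
    by rewrite /c1; converge.
  have c0c : convergent v c0.
    by rewrite /c0; converge.
  exists (fun i : 'I_2 => if i == ord0 then c0 else c1).
    by move=> i; case: ifP.
  rewrite !big_ord_recl big_ord0 addr0 !(tnth_nth 0) /=.
  rewrite hkE /c0 /c1 /p /q /r /F0 /F1; ring.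
exists k; have [c cc hkE] := hk; split; first exact: convergentX.
rewrite hkE !big_ord_recl big_ord0 addr0 !(tnth_nth 0) /=.
by rewrite fps_substD !(fps_substM xi0) F0E F1E !mulr0 addr0.
Qed.

End Determinantal.

Section DeformedMatrix.
Variables (R : realType) (K : fieldType) (v : K -> R).
Hypothesis v_abs : absolute_value v.
Variables (a b : nat).
Hypotheses (a_ge2 : (2 <= a)%N) (b_ge2 : (2 <= b)%N).
Notation l := (b + 2)%N.
Notation m := (2 * a + 1)%N.
Notation n := (a * b + b + 1)%N.
Notation d1 := ((a + 1) * (b + 2))%N.
Notation Gamma := (numerical_semigroup l m n).
Hypothesis lm_coprime : gcdn l m = 1%N.
Variables (delta gamma : nat) (y z : fps 1 K).
Hypothesis delta_gt0 : (0 < delta)%N.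
Notation t := (tvar K).
Hypothesis yE : tord_ge (m + delta) (y - t ^+ m).
Hypothesis zE : tord_ge (n + delta) (z - t ^+ n).
Hypotheses (yc : convergent v y) (zc : convergent v z).
Hypothesis above : forall k, (gamma <= k)%N -> Gamma k.
Hypothesis gamma_le : (gamma + l <= d1 + delta)%N.

Notation C := (curve l y z).
Notation W3 := (w3 l m n).
Notation ev := (fps_subst C).

Let l_gt0 : (0 < l)%N. Proof. by lia. Qed.
Let m_gt0 : (0 < m)%N. Proof. by lia. Qed.
Let n_gt0 : (0 < n)%N. Proof. by lia. Qed.
Let C0 := curve0 l_gt0 m_gt0 n_gt0 yE zE.

Notation x := (Xmon (mon3 1 0 0) : fps 3 K).
Notation Y := (Xmon (mon3 0 1 0) : fps 3 K).
Notation Z := (Xmon (mon3 0 0 1) : fps 3 K).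

Lemma ev_mon3 i j h : ev (Xmon (mon3 i j h)) = t ^+ (l * i) * y ^+ j * z ^+ h.
Proof. by rewrite (fps_substXmon C0) mon_mon3. Qed.

Lemma XmonE i j h : Xmon (mon3 i j h) = x ^+ i * Y ^+ j * Z ^+ h.
Proof.
rewrite !XmonX !XmonM; congr Xmon; apply/mnmP; apply: ord3P;
  by rewrite !mnmDE !mulmnE /mon3 !mnmE /=; lia.
Qed.

(** The quotient by [x] of an element of the curve ring that is close to
    [x X^k] is again in the curve ring: it differs from [X^k] by a series of
    order beyond the conductor. *)
Lemma near_quotient c (f : fps 1 K) k : near delta (wt W3 k + l) f ->
  convergent v f -> c = (wt W3 k + delta)%N -> (gamma <= c)%N ->
  exists e, [/\ convergent v e, vanish_below W3 c e &
    ev ((Xmon k + e) * x) = f].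
Proof.
move=> fk fc ec le.
pose h := f - t ^+ l * ev (Xmon k).
have h0 : tord_ge (l + c) h.
  have xk : near delta (wt W3 k + l) (t ^+ l * ev (Xmon k)).
    rewrite (fps_substXmon C0) mulrC; apply: nearM; first exact: near_mon.
    exact: near_tvarX.
  have -> : h = (f - t ^+ (wt W3 k + l)) -
      (t ^+ l * ev (Xmon k) - t ^+ (wt W3 k + l)) by rewrite /h; ring.
  have -> : (l + c = wt W3 k + l + delta)%N by lia.
  exact: tord_geB.
have [|||e [ec1 ec2 ec3]] := @representation _ _ _ v_abs l m n delta y z
    l_gt0 m_gt0 n_gt0 delta_gt0 yE zE yc zc c (strip xpredT (tdeg l) h).
- by move=> i lei; apply: above; apply: leq_trans lei.
- apply: convergent_strip => //; apply: convergentB => //.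
  apply: convergentM => //; first exact: convergent_tvarX.
  by rewrite (fps_substXmon C0); apply: convergent_subst_mon.
- exact: tord_ge_strip.
exists e; split=> //.
have evx : ev x = t ^+ l by rewrite ev_mon3 muln1 !expr0 !mulr1.
rewrite (fps_substM C0) fps_substD ec2 evx mulrC mulrDr.
rewrite (tvar_dvd (d := l)); first by rewrite /h; ring.
by apply: tord_geW h0; rewrite leq_addr.
Qed.


Section Minors.
Variables (alpha1 beta1 : fps 3 K).
Hypotheses (a1c : convergent v alpha1) (b1c : convergent v beta1).
Hypothesis alpha1_high : vanish_below W3 (a * l + delta) alpha1.
Hypothesis beta1_high : vanish_below W3 (b * m + delta) beta1.
Notation alpha := (Xmon (mon3 a 0 0) + alpha1).
Notation beta := (Xmon (mon3 0 b 0) + beta1).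
Hypothesis minors0 : forall i, ev (tnth (minors alpha beta) i) = 0.

(* Adding 1 to the weight of [x] makes [y z], [y ^ b.+1] and [z ^ 2] the unique
   monomials of least weight in the minors: all other terms of these contain [x]
   or had larger weight already. *)
Notation w := (w3 l.+1 m n).

Lemma vanish_below_w d (f : fps 3 K) :
  vanish_below W3 d f -> vanish_below w d f.
Proof.
move=> f0 k lt; apply: f0; apply: leq_ltn_trans lt; rewrite !wt_w3; nia.
Qed.

Definition lead (i : 'I_3) : 'X_{1..3} :=
  tnth [tuple mon3 0 1 1; mon3 0 b.+1 0; mon3 0 0 2] i.
(** The parts of the division are chosen such that every monomial divisible by
    a leading monomial is assigned to exactly one minor. *)
Definition lead_dom (i : 'I_3) : pred 'X_{1..3} :=
  tnth [tuple (fun=> true); (fun k => k iz == 0%N); (fun k => k iy == 0%N)] i.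
Definition tail (i : 'I_3) : fps 3 K :=
  tnth [tuple alpha * x; Z * alpha - Y * beta1; beta * x] i.

Lemma lead_minors i : tnth (minors alpha beta) i = Xmon (lead i) - tail i.
Proof.
elim/ord3P: i; rewrite /lead /tail /minors !(tnth_nth 0) !(tnth_nth 0%MM) /=.
- by rewrite [Xmon (mon3 0 1 1)]XmonE; ring.
- rewrite [Xmon (mon3 0 b.+1 0)]XmonE [Xmon (mon3 0 b 0)]XmonE exprS; ring.
- by rewrite [Xmon (mon3 0 0 2)]XmonE; ring.
Qed.

Lemma tail_high i : vanish_below w (wt w (lead i)).+1 (tail i).
Proof.
have Xw k : vanish_below w (wt w k) (Xmon k : fps 3 K).
  exact: vanish_below_Xmon.
have a1w := vanish_below_w alpha1_high; have b1w := vanish_below_w beta1_high.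
have ryz := rel_yz a b; have rzz := rel_zz a b; have ry := rel_y a b.
elim/ord3P: i; rewrite /lead /tail !(tnth_nth 0) !(tnth_nth 0%MM) /=.
- rewrite mulrDl; apply: vanish_belowD.
    apply: vanish_belowW (vanish_belowM (Xw _) (Xw _)).
    by rewrite !wt_mon3; nia.
  apply: vanish_belowW (vanish_belowM a1w (Xw _)).
  by rewrite !wt_mon3; nia.
- rewrite mulrDr; apply: vanish_belowB; first apply: vanish_belowD.
  + apply: vanish_belowW (vanish_belowM (Xw _) (Xw _)).
    by rewrite !wt_mon3; nia.
  + apply: vanish_belowW (vanish_belowM (Xw _) a1w).
    by rewrite !wt_mon3; nia.
  + apply: vanish_belowW (vanish_belowM (Xw _) b1w).
    by rewrite !wt_mon3; nia.
- rewrite mulrDl; apply: vanish_belowD.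
    apply: vanish_belowW (vanish_belowM (Xw _) (Xw _)).
    by rewrite !wt_mon3; nia.
  apply: vanish_belowW (vanish_belowM b1w (Xw _)).
  by rewrite !wt_mon3; nia.
Qed.

Definition std : pred 'X_{1..3} := fun k =>
  (k iz == 0%N) && (k iy <= b)%N || (k iz == 1%N) && (k iy == 0%N).

Lemma std_decomposition (u : fps 3 K) k : ~~ std k ->
  u k = (\sum_i strip (lead_dom i) (lead i) u * Xmon (lead i)) k.
Proof.
move=> nstd; rewrite fps_coef_sum.
have term i : (strip (lead_dom i) (lead i) u * Xmon (lead i)) k =
    if (lead i <= k)%MM && lead_dom i (k - lead i)%MM then u k else 0.
  rewrite mulrC Xmon_mul_coef; case: ifPn => //= le.
  by rewrite addmC submK.
rewrite !big_ord_recl big_ord0 !term addr0.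
rewrite /lead /lead_dom !(tnth_nth 0%MM) !(tnth_nth xpredT) /= !mon3_le !mnmBE.
rewrite /mon3 !mnmE /= !subn0 !andbT; move: nstd; rewrite /std.
case: (k iy) (k iz) => [|j] [|[|h]] //=; rewrite ?andbF ?andbT ?orbF /=.
- by rewrite !add0r.
- by rewrite -leqNgt ltnS => ->; rewrite add0r addr0.
- by rewrite !addr0.
- by rewrite !addr0.
Qed.

(** The remainder of the division of [h] by the minors vanishes on the curve
    as well, and the standard monomials have distinct orders there. *)
Lemma minors_generate h : convergent v h -> ev h = 0 ->
  generated_ideal v (minors alpha beta) h.
Proof.
move=> hc h0.
have [|u uE uc] := @division _ _ _ v_abs 3 w 3 lead lead_dom tail h _ tail_high.
  by apply: ord3P.
have alphac : convergent v alpha by converge.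
have betac : convergent v beta by converge.
have {}uc : convergent v u.
  by apply: uc => //; apply: ord3P; rewrite /tail !(tnth_nth 0) /=; converge.
pose A i := strip (lead_dom i) (lead i) u.
pose rem := u - \sum_i A i * Xmon (lead i).
have hE : h = rem + \sum_i A i * tnth (minors alpha beta) i.
  have -> : h = u - \sum_i A i * tail i by rewrite {1}uE addrK.
  rewrite /rem -addrA; congr (_ + _).
  rewrite -sumrN -[X in X + _]sumrN -big_split; apply: eq_bigr => i _ /=.
  by rewrite lead_minors mulrBr addKr.
suff rem0 : rem = 0.
  exists A; last by rewrite hE rem0 add0r.
  by move=> i; apply: convergent_strip.
apply: (ev_independent l_gt0 m_gt0 n_gt0 delta_gt0 yE zE (P := std)).
- move=> k k' kstd kstd'; rewrite !wt_w3 => e.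
  have [] := @standard_unique a b a_ge2 b_ge2 lm_coprime (k ix) (k iy) (k iz)
    (k' ix) (k' iy) (k' iz) _ _ e.
  + by case/orP: kstd => /andP[/eqP-> ?]; [left|right; split=> //; apply/eqP].
  + by case/orP: kstd' => /andP[/eqP-> ?]; [left|right; split=> //; apply/eqP].
  by move=> e1 e2 e3; rewrite (mon3_eta k) (mon3_eta k') e1 e2 e3.
- by move=> k nstd; rewrite /rem fps_coefB -std_decomposition // subrr.
have sum0 : \sum_i ev (A i * tnth (minors alpha beta) i) = 0.
  by apply: big1 => i _; rewrite (fps_substM C0) minors0 mulr0.
by have := h0; rewrite hE fps_substD fps_subst_sum sum0 addr0.
Qed.

End Minors.

(** The matrix [(x ^ a, y ^ b, z; y, z, x)], whose minors define the monomial
    curve, deforms to [(y z / x, z ^ 2 / x, z; y, z, x)]. Its symmetric part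
    persists, and its minors vanish by construction. *)
Lemma near_monomial_ci : set_theoretic_ci_space_curve v C.
Proof.
have ryz := rel_yz a b; have rzz := rel_zz a b.
have ymon : near delta m y by [].
have zmon : near delta n z by [].
have ab2 : (a * 2 <= a * b)%N by rewrite leq_mul2l b_ge2 orbT.
have [||||e1 [e1c e1_high e1E]] :=
    @near_quotient (a * l + delta)%N (y * z) (mon3 a 0 0).
- by have := nearM ymon zmon; rewrite wt_mon3; congr near; lia.
- exact: convergentM.
- by rewrite wt_mon3; lia.
- by lia.
have [||||e2 [e2c e2_high e2E]] :=
    @near_quotient (b * m + delta)%N (z * z) (mon3 0 b 0).
- by have := nearM zmon zmon; rewrite wt_mon3; congr near; lia.
- exact: convergentM.
- by rewrite wt_mon3; lia.
- by lia.
have evy : ev Y = y by rewrite ev_mon3 muln0 !expr0 mul1r mulr1 expr1.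
have evz : ev Z = z by rewrite ev_mon3 muln0 !expr0 !mul1r expr1.
have evx : ev x = t ^+ l by rewrite ev_mon3 muln1 !expr0 !mulr1.
have alphaE : ev ((Xmon (mon3 a 0 0) + e1) * x) = ev (Y * Z).
  by rewrite e1E (fps_substM C0) evy evz.
have betaE : ev ((Xmon (mon3 0 b 0) + e2) * x) = ev (Z * Z).
  by rewrite e2E (fps_substM C0) evz.
apply: (determinantal_ci v_abs (d := l) C0 _ _ _ alphaE betaE) => //.
- by apply: convergentD => //; apply: convergent_mon.
- by apply: convergentD => //; apply: convergent_mon.
apply: minors_generate => //; apply: ord3P; rewrite (tnth_nth 0) /=.
- by rewrite fps_substB alphaE subrr.
- apply: (@tshift_inj _ l); rewrite mulr0 -evx -(fps_substM C0).
  set al := Xmon _ + e1; set be := Xmon _ + e2.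
  have -> : x * (be * Y - Z * al) = (be * x) * Y - Z * (al * x) by ring.
  rewrite fps_substB (fps_substM C0 _ Y) (fps_substM C0 Z) betaE alphaE.
  by rewrite -!(fps_substM C0) -fps_substB; 
     rewrite (_ : _ - _ = 0) ?fps_subst0 //; ring.
by rewrite fps_substB betaE subrr.
Qed.

End DeformedMatrix.

(** * Units, roots and supports of power series in one variable *)

Section CauchyProduct.
Variable K : comNzRingType.
Implicit Types f g V : fps 1 K.
Notation t := (tvar K).

Lemma coM f g d : co (f * g) d = \sum_(i < d.+1) co f i * co g (d - i).
Proof.
elim: d f => [|d IH] f; first by rewrite big_ord1 coM0.
pose f1 := strip xpredT (tdeg 1) (f - fpsC (co f 0)).
have fE : f = fpsC (co f 0) + t ^+ 1 * f1.
  rewrite tvar_dvd; first by rewrite addrC subrK.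
  by move=> [|//] _; rewrite coB coC eqxx subrr.
have f1E i : co f1 i = co f i.+1.
  by rewrite -(co_tshift 1) [in RHS]fE coD coC add0r.
rewrite big_ord_recl subn0 {1}fE mulrDl coD coMC; congr (_ + _).
rewrite -mulrA (co_tshift 1 _ d) IH; apply: eq_bigr => i _.
by rewrite f1E.
Qed.

(** Euler's derivation [t d/dt]. *)
Definition theta f : fps 1 K := Fps (fun k => (mdeg k)%:R * f k).

Lemma co_theta f d : co (theta f) d = d%:R * co f d.
Proof. by rewrite /co /= mdeg_tdeg. Qed.

Lemma thetaM f g : theta (f * g) = theta f * g + f * theta g.
Proof.
apply: coP => d; rewrite coD co_theta !coM mulr_sumr.
transitivity (\sum_(i < d.+1) (co (theta f) i * co g (d - i) +
    co f i * co (theta g) (d - i))); last exact: big_split.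
apply: eq_bigr => i _; rewrite !co_theta.
rewrite -{1}(subnKC (_ : i <= d)%N) ?natrD; last by rewrite -ltnS.
by ring.
Qed.

Lemma thetaX V e : theta (V ^+ e.+1) = e.+1%:R * (V ^+ e * theta V).
Proof.
elim: e => [|e IH]; first by rewrite expr1 expr0 !mul1r.
rewrite exprS thetaM IH exprS -natr1.
by ring.
Qed.

(** Powers with exponent 0 in [K] have derivative 0. *)
Lemma coX_char V e d : e.+1%:R = 0 :> K -> d%:R * co (V ^+ e.+1) d = 0.
Proof.
move=> e0; rewrite -co_theta thetaX.
have -> : e.+1%:R = fpsC (e.+1%:R) :> fps 1 K by rewrite rmorph_nat.
by rewrite coMC e0 mul0r.
Qed.

Section SupportInMonoid.
Variable D : nat -> Prop.
Hypotheses (D0 : D 0%N) (DD : forall d e, D d -> D e -> D (d + e)%N).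

Definition supp_below d f := forall e, (e < d)%N -> co f e != 0 -> D e.

Lemma supp_belowM d f g :
  supp_below d f -> supp_below d g -> supp_below d (f * g).
Proof.
move=> fD gD e lt /coM_neq0 [i [j [eij fi gj]]]; rewrite eij.
by apply: DD; [apply: fD|apply: gD] => //; lia.
Qed.

Lemma supp_belowX d f k : supp_below d f -> supp_below d (f ^+ k).
Proof.
move=> fD; elim: k => [|k IH]; last by rewrite exprS; apply: supp_belowM.
rewrite expr0 -(expr0 t) => e lt; rewrite co_tvarX.
by case: (e =P 0%N) => [-> //|_]; rewrite eqxx.
Qed.

Lemma coM_outside d f g : supp_below d f -> supp_below d g -> ~ D d ->
  co (f * g) d = co f 0 * co g d + co f d * co g 0.
Proof.
move=> fD gD nD; rewrite coM; case: d fD gD nD => [//|d] fD gD nD.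
rewrite big_ord_recl big_ord_recr /= subn0 subnn; congr (_ + _).
rewrite big1 ?add0r // => i _.
have [->|fi] := eqVneq (co f (bump 0 i)) 0; first by rewrite mul0r.
have [->|gi] := eqVneq (co g (d.+1 - bump 0 i)) 0; first by rewrite mulr0.
have lti := ltn_ord i; rewrite /bump /= in fi gi; case: nD.
have -> : (d.+1 = (1 + i) + (d.+1 - (1 + i)))%N by lia.
by apply: DD; [apply: fD|apply: gD] => //; lia.
Qed.

(** At the first exponent of [V] outside a monoid [D], powers of [V] depend
    linearly on the coefficient of [V]: products of the earlier terms have
    exponents in [D]. *)
Lemma coX_outside d V e : supp_below d V -> ~ D d ->
  co (V ^+ e.+1) d = e.+1%:R * co V 0 ^+ e * co V d.
Proof.
move=> VD nD; elim: e => [|e IH]; first by rewrite expr1 expr0 !mul1r.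
rewrite exprS coM_outside ?IH ?coX0 //; last exact: supp_belowX.
by rewrite -[e.+2%:R]natr1 [co V 0 ^+ e.+1]exprS; ring.
Qed.

End SupportInMonoid.
End CauchyProduct.

Section Units.
Variables (R : realType) (K : fieldType) (v : K -> R).
Hypothesis v_abs : absolute_value v.
Notation t := (tvar K).

Lemma fps_inverse r (f : fps r K) : f 0%MM != 0 ->
  exists2 u, f * u = 1 & convergent v f -> convergent v u.
Proof.
move=> f0; pose c := (f 0%MM)^-1; pose tau := 1 - fpsC c * f.
have [|u uE uc] := @division _ _ _ v_abs r (fun=> 1%N) 1 (fun=> 0%MM)
  (fun=> xpredT) (fun=> tau) (fpsC c) (fun=> isT).
  move=> _ k; rewrite !wt_const1 mdeg0 ltnS leqn0 mdeg_eq0 => /eqP->.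
  by rewrite fps_coefB fps_coefMC fps_coef1 eqxx mulVf // subrr.
exists u; last first.
  move=> fc; apply: uc => [|_]; first exact: convergentC.
  by rewrite /tau; apply: convergentB;
    [|apply: convergent1|apply: convergentM => //; apply: convergentC].
have sE : strip xpredT 0%MM u = u by apply: fpsP => k; rewrite /= add0m.
rewrite big_ord1 sE in uE.
have cfc : fpsC (f 0%MM) * fpsC c = 1 :> fps r K.
  by rewrite -rmorphM mulfV // rmorph1.
have : u * (1 - tau) = fpsC c by rewrite mulrBr mulr1 {1}uE addrK.
rewrite /tau opprB addrC subrK => uc1; rewrite -[LHS]mul1r -{1}cfc.
have -> : fpsC (f 0%MM) * fpsC c * (f * u) = fpsC (f 0%MM) * (u * (fpsC c * f)).
  by ring.
by rewrite uc1.
Qed.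

Lemma tvar_factor (f : fps 1 K) : f != 0 ->
  exists d g, f = t ^+ d * g /\ co g 0 != 0.
Proof.
move=> f0; have ex : exists d, co f d != 0.
  apply: contrapT => H; case/eqP: f0; apply: coP => d; rewrite co0.
  by apply: contrapT => fd; apply: H; exists d; apply/eqP.
case: (ex_minnP ex) => d fd dmin.
exists d, (strip xpredT (tdeg d) f); rewrite tvar_dvd.
  by split=> //; rewrite /co /= -tdegD addn0.
by move=> e lt; apply/eqP/negPn/negP => /dmin; rewrite leqNgt lt.
Qed.

Lemma tvar_factor_uniq d e (f g : fps 1 K) : co f 0 != 0 -> co g 0 != 0 ->
  t ^+ d * f = t ^+ e * g -> d = e /\ f = g.
Proof.
wlog le : d e f g / (d <= e)%N.
  move=> H f0 g0 eq; case: (leqP d e) => [|/ltnW] le; first exact: H.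
  by have [-> ->] := H _ _ _ _ le g0 f0 (esym eq).
move=> f0 g0 eq; have de : d = e.
  apply/eqP; rewrite eqn_leq le leqNgt; apply/negP => lt.
  case/eqP: f0; rewrite -(co_tshift d f 0) addn0 eq.
  have g1 : tord_ge 0 g by [].
  by have := tord_geM (@tord_ge_tvarX K e) g1; apply; rewrite addn0.
by split=> //; subst e; apply: tshift_inj eq.
Qed.

(** The common root is [B ^ s / A ^ r], where [s m - r l = 1]. *)
Lemma common_root l m (A B : fps 1 K) : (0 < m)%N -> coprime m l ->
  co A 0 != 0 -> co B 0 != 0 -> A ^+ m = B ^+ l ->
  exists V, [/\ co V 0 != 0, V ^+ l = A & V ^+ m = B].
Proof.
move=> m0 co_ml A0 B0 AB.
have [[s r] /= sr] : exists u, (u.1 * m - u.2 * l = 1)%N.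
  exact/(coprimeP l m0).
have {}sr : (s * m = r * l + 1)%N by lia.
have A0' : A 0%MM != 0 by rewrite -tdeg0.
have [I AI _] := fps_inverse A0'.
have AIX e : A ^+ e * I ^+ e = 1 by rewrite -exprMn AI expr1n.
exists (B ^+ s * I ^+ r); split.
- rewrite coM0 !coX0 mulf_neq0 ?expf_neq0 //; apply/eqP => I0.
  have /eqP := congr1 (fun f => co f 0) AI.
  by rewrite coM0 I0 mulr0 -(expr0 t) co_tvarX eqxx eq_sym oner_eq0.
- rewrite exprMn -!exprM mulnC exprM -AB -exprM mulnC sr exprD.
  by rewrite mulrAC AIX mul1r expr1.
- rewrite exprMn -!exprM sr exprD mulnC exprM -AB -exprM.
  by rewrite mulrAC mulnC AIX mul1r expr1.
Qed.

End Units.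

(** * Isomorphisms with a monomial curve *)

Section AnalyticSubalgebra.
Variables (R : realType) (K : fieldType) (v : K -> R).
Hypothesis v_abs : absolute_value v.
Variables (r : nat) (xi : r.-tuple (fps 1 K)).
Hypothesis xi0 : forall i, tnth xi i 0%MM = 0.
Notation A := (analytic_subalgebra v xi).

Lemma analytic_subst f : convergent v f -> A (fps_subst xi f).
Proof. by exists f. Qed.

Lemma analyticC c : A (fpsC c).
Proof. by exists (fpsC c); [apply: convergentC|apply: fps_substC]. Qed.

Lemma analytic_mon k : A (subst_mon xi k).
Proof. by exists (Xmon k); [apply: convergent_mon|apply: fps_substXmon]. Qed.

Lemma analyticD f g : A f -> A g -> A (f + g).
Proof.
move=> [f' fc <-] [g' gc <-]; exists (f' + g'); last exact: fps_substD.
exact: convergentD.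
Qed.

Lemma analyticM f g : A f -> A g -> A (f * g).
Proof.
move=> [f' fc <-] [g' gc <-]; exists (f' * g'); last exact: fps_substM.
exact: convergentM.
Qed.

Lemma analyticX f e : A f -> A (f ^+ e).
Proof.
move=> Af; elim: e => [|e IH]; first exact: (analyticC 1).
by rewrite exprS; apply: analyticM.
Qed.

Lemma analytic_inverse f : A f -> co f 0 != 0 -> exists2 g, A g & f * g = 1.
Proof.
move=> [f' fc <-] f0.
have f'0 : f' 0%MM != 0.
  have lt0 : (mdeg (0%MM : 'X_{1..1}) < 1)%N by rewrite mdeg0.
  apply: contraNneq f0 => f'0; rewrite /co tdeg0 (fps_subst_coef xi0 _ lt0).
  rewrite big1 // => k _.
  suff -> : (k : 'X_{1..r}) = 0%MM by rewrite f'0 mul0r.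
  by apply/eqP; rewrite -mdeg_eq0 -leqn0 -ltnS bmdeg.
have [u fu uc] := fps_inverse v_abs f'0.
exists (fps_subst xi u); first by apply: analytic_subst; apply: uc.
by rewrite -(fps_substM xi0) fu (fps_subst1 xi0).
Qed.

End AnalyticSubalgebra.

Section Isomorphism.
Variables (R : realType) (K : fieldType) (v : K -> R).
Hypothesis v_abs : absolute_value v.
Variables (l m n delta : nat) (y z : fps 1 K).
Hypotheses (l_gt0 : (0 < l)%N) (m_gt0 : (0 < m)%N) (mn : (m < n)%N).
Hypothesis delta_gt0 : (0 < delta)%N.
Notation t := (tvar K).
Hypothesis yE : tord_ge (m + delta) (y - t ^+ m).
Hypothesis zE : tord_ge (n + delta) (z - t ^+ n).
Hypothesis lm_coprime : coprime m l.

Let n_gt0 : (0 < n)%N. Proof. by lia. Qed.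

Notation C := (curve l y z).
Notation M := (curve l (t ^+ m) (t ^+ n)).
Notation A := (analytic_subalgebra v C).
Notation B := (analytic_subalgebra v M).

Let C0 := curve0 l_gt0 m_gt0 n_gt0 yE zE.
Let M0 i : tnth M i 0%MM = 0.
Proof.
by apply: (@curve0 K l m n 1 (t ^+ m) (t ^+ n)) => // e _; rewrite subrr co0.
Qed.

Lemma monomial_decomposition g : B g -> exists c g1 g2 g3,
  [/\ B g1, B g2, B g3 &
      g = fpsC c + t ^+ l * g1 + t ^+ m * g2 + t ^+ n * g3].
Proof.
move=> [f fc <-].
pose f1 := strip xpredT (mon3 1 0 0) f.
pose f2 := strip (fun k => k ix == 0%N) (mon3 0 1 0) f.
pose f3 := strip (fun k => (k ix == 0%N) && (k iy == 0%N)) (mon3 0 0 1) f.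
have fE : f = fpsC (f 0%MM) + Xmon (mon3 1 0 0) * f1 +
    Xmon (mon3 0 1 0) * f2 + Xmon (mon3 0 0 1) * f3.
  apply: fpsP => k; rewrite !fps_coefD !Xmon_mul_coef.
  have mon0 : (k == 0%MM) = [&& k ix == 0%N, k iy == 0%N & k iz == 0%N].
    apply/eqP/and3P => [->|[/eqP e1 /eqP e2 /eqP e3]].
      by rewrite !mnm0E.
    by apply/mnmP; apply: ord3P; rewrite mnm0E.
  have strE (P : pred 'X_{1..3}) N :
      (if (N <= k)%MM then strip P N f (k - N)%MM else 0) =
      if (N <= k)%MM && P (k - N)%MM then f k else 0.
    by case: ifP => //= le; rewrite addmC submK.
  have -> : fpsC (f 0%MM) k = if (k == 0%MM) then f k else 0.
    by rewrite /=; case: eqP => [->|].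
  rewrite !strE !mon3_le mon0 !mnmBE /mon3 !mnmE /= !subn0.
  by case: (k ix) (k iy) (k iz) => [|i] [|j] [|h] /=;
    rewrite ?addr0 ?add0r ?andbF.
exists (f 0%MM), (fps_subst M f1), (fps_subst M f2), (fps_subst M f3); split.
- by apply: analytic_subst; apply: convergent_strip.
- by apply: analytic_subst; apply: convergent_strip.
- by apply: analytic_subst; apply: convergent_strip.
rewrite {1}fE !fps_substD !(fps_substM M0) (fps_substC M0) !(fps_substXmon M0).
by rewrite !mon_mon3 muln1 muln0 !expr0 !mulr1 !mul1r !expr1.
Qed.

(** An isomorphism of algebras, continuous or not, preserves binomial relations
    between elements, units, and generators of the maximal ideal. The first
    forces the orders of the preimages [X], [Y], [Z] of [t ^ l], [t ^ m],
    [t ^ n] to be [e l], [e m], [e n] for some [e]; the other two give [e = 1].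
    The relation [X ^ m = Y ^ l] then turns [X] and [Y] into powers of a
    parameter [t V]. *)
Lemma isomorphic_monomial : isomorphic_subalgebras A B ->
  exists V, [/\ co V 0 != 0, A (t ^+ l * V ^+ l) & A (t ^+ m * V ^+ m)].
Proof.
move=> [phi [[phiB phiI phiS] phiC phiD phiM]].
have inj f g : A f -> A g -> phi f = phi g -> f = g.
  by move=> Af Ag; apply: phiI; rewrite inE.
have AC c : A (fpsC c) by apply: analyticC.
have AD f g : A f -> A g -> A (f + g) by apply: analyticD.
have AM f g : A f -> A g -> A (f * g) by apply: analyticM.
have AX f e : A f -> A (f ^+ e) by apply: analyticX.
have phi1 : phi 1 = 1 by apply: (phiC 1).
have phi0 : phi 0 = 0 by apply: (phiC 0).
have phiX f e : A f -> phi (f ^+ e) = phi f ^+ e.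
  by move=> Af; elim: e => [//|e IH]; rewrite !exprS phiM ?IH //; apply: AX.
have Bmon i : B (tnth M i) by rewrite -subst_mon1; apply: analytic_mon.
have [X AX0 phiXE] : exists2 X, A X & phi X = t ^+ l by apply/phiS/(Bmon ix).
have [Y AY0 phiYE] : exists2 Y, A Y & phi Y = t ^+ m by apply/phiS/(Bmon iy).
have [Z AZ0 phiZE] : exists2 Z, A Z & phi Z = t ^+ n by apply/phiS/(Bmon iz).
have tX0 e : t ^+ e != 0.
  apply/eqP => /(congr1 (fun f => co f e)) /eqP.
  by rewrite co0 co_tvarX eqxx oner_eq0.
have nz f e : phi f = t ^+ e -> f != 0.
  by move=> fe; apply: contraTneq (tX0 e) => f0; rewrite -fe f0 phi0 eqxx.
have XY : X ^+ m = Y ^+ l.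
  apply: inj; [exact: AX|exact: AX|].
  by rewrite !phiX // phiXE phiYE -!exprM mulnC.
have XZ : X ^+ n = Z ^+ l.
  apply: inj; [exact: AX|exact: AX|].
  by rewrite !phiX // phiXE phiZE -!exprM mulnC.
have [i [X1 [XE X10]]] := tvar_factor (nz _ _ phiXE).
have [j [Y1 [YE Y10]]] := tvar_factor (nz _ _ phiYE).
have [h [Z1 [ZE Z10]]] := tvar_factor (nz _ _ phiZE).
have expn0 (f : fps 1 K) e : co f 0 != 0 -> co (f ^+ e) 0 != 0.
  by move=> f0; rewrite coX0 expf_neq0.
have [ij XY1] : (i * m = j * l)%N /\ X1 ^+ m = Y1 ^+ l.
  by apply: tvar_factor_uniq; rewrite ?expn0 // !exprM -!exprMn -XE -YE.
have [ih _] : (i * n = h * l)%N /\ X1 ^+ n = Z1 ^+ l.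
  by apply: tvar_factor_uniq; rewrite ?expn0 // !exprM -!exprMn -XE -ZE.
have [e ie] : exists e, i = (e * l)%N.
  apply/dvdnP; rewrite -(Gauss_dvdl i (_ : coprime l m)) 1?coprime_sym // ij.
  exact: dvdn_mull.
have je : j = (e * m)%N by apply/eqP; rewrite -(eqn_pmul2r l_gt0) -ij ie mulnAC.
have he : h = (e * n)%N by apply/eqP; rewrite -(eqn_pmul2r l_gt0) -ih ie mulnAC.
(* Otherwise [X] minus its constant term is a non-unit with unit image. *)
have e_gt0 : (0 < e)%N.
  rewrite lt0n; apply/eqP => e0; pose c := co X 0.
  have c0 : c != 0 by rewrite /c XE ie e0 mul0n expr0 mul1r.
  have Bt : B (t ^+ l + fpsC (- c)).
    by apply: analyticD => //; [exact: (Bmon ix)|exact: analyticC].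
  have [|g Bg tg] := analytic_inverse v_abs M0 Bt.
    by rewrite coD coC co_tvarX (ltn_eqF l_gt0) add0r oppr_eq0.
  have [G AG phiG] := phiS _ Bg.
  have /eqP : (X + fpsC (- c)) * G = 1.
    have AXc : A (X + fpsC (- c)) by apply: AD.
    apply: inj => //; [exact: AM|exact: (AC 1)|].
    by rewrite phiM // phiD // phiC phiXE phiG phi1.
  apply/negP/eqP => /(congr1 (fun f => co f 0)).
  rewrite coM0 coD coC eqxx /c subrr mul0r -(expr0 t) co_tvarX eqxx.
  by move/eqP; rewrite eq_sym oner_eq0.
(* Otherwise no element without constant term has order [minn l m]. *)
have e1 : e = 1%N.
  apply/eqP; rewrite eqn_leq e_gt0 andbT leqNgt; apply/negP => e_gt1.
  pose mu := minn l m.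
  have [w Aw [w1 w0]] : exists2 w, A w & co w mu = 1 /\ co w 0 = 0.
    have mu_gt0 : (0 < mu)%N by rewrite leq_min l_gt0.
    have ynear : near delta m y by [].
    have tnear : near delta l (t ^+ l) by apply: near_tvarX.
    have Amon i' : A (tnth C i') by rewrite -subst_mon1; apply: analytic_mon.
    have lead d f : near delta d f -> (0 < d)%N -> co f d = 1 /\ co f 0 = 0.
      move=> fd d0; rewrite !(near_coef fd) ?eqxx; try by lia.
      by rewrite ltn_eqF.
    rewrite /mu /minn; case: ifP => _.
      by exists (t ^+ l); [apply: (Amon ix)|apply: lead].
    by exists y; [apply: (Amon iy)|apply: lead].
  have [c [g1 [g2 [g3 [Bg1 Bg2 Bg3 gE]]]]] :=
    monomial_decomposition (phiB _ Aw).
  have [G1 AG1 phiG1] := phiS _ Bg1.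
  have [G2 AG2 phiG2] := phiS _ Bg2.
  have [G3 AG3 phiG3] := phiS _ Bg3.
  have wE : w = fpsC c + X * G1 + Y * G2 + Z * G3.
    have [A1 A2 A3] : [/\ A (X * G1), A (Y * G2) & A (Z * G3)].
      by split; apply: AM.
    have A4 : A (fpsC c + X * G1) by apply: AD.
    have A5 : A (fpsC c + X * G1 + Y * G2) by apply: AD.
    apply: inj => //; first exact: AD.
    rewrite gE !phiD ?phiM //.
    by rewrite phiC phiXE phiYE phiZE phiG1 phiG2 phiG3.
  have low i' (f g : fps 1 K) : (mu < i')%N -> co (t ^+ i' * f * g) mu = 0.
    move=> lt; have f0 : tord_ge 0 (f * g) by [].
    rewrite -mulrA; have := tord_geM (@tord_ge_tvarX K i') f0.
    by apply; rewrite addn0.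
  have mu_gt0 : (0 < mu)%N by rewrite leq_min l_gt0.
  have [bi bj bh] : [/\ mu < i, mu < j & mu < h]%N.
    by rewrite ie je he /mu; split; nia.
  move: w1; rewrite wE !coD coC XE YE ZE !low // !addr0 gtn_eqF //.
  by move/eqP; rewrite eq_sym oner_eq0.
have [V [V0 VX VY]] := common_root v_abs m_gt0 lm_coprime X10 Y10 XY1.
rewrite e1 mul1n in ie; rewrite e1 mul1n in je.
rewrite XE ie in AX0; rewrite YE je in AY0.
by exists V; rewrite VX VY.
Qed.

End Isomorphism.

(** * The deformation in direction [t ^ (gamma - 1 - l)] *)

Lemma co_powD (K : comNzRingType) m p (f : fps 1 K) j e : (m <= p)%N ->
  (forall e, co f e != 0 -> e = m \/ e = p) ->
  co (f ^+ j) e != 0 -> exists2 j', (j' <= j)%N & e = (j * m + j' * (p - m))%N.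
Proof.
move=> mp fS; elim: j e => [|j IH] e.
  rewrite expr0 -(expr0 (tvar K)) co_tvarX; case: (e =P 0%N) => [->|_].
    by exists 0%N.
  by rewrite eqxx.
rewrite exprS => /coM_neq0 [e1 [e2 [-> /fS e1E /IH [j' le ->]]]].
case: e1E => ->; first by exists j'; [exact: leqW|lia].
by exists j'.+1; [|rewrite mulSn; lia].
Qed.

Lemma closed_support (K : comNzRingType) (D : nat -> Prop) N (V : fps 1 K) :
  (forall d, (d < N)%N -> supp_below D d V -> ~ D d -> co V d = 0) ->
  supp_below D N V.
Proof.
move=> H; elim/ltn_ind=> e IH lt Ve; apply: contrapT => nD.
case/eqP: Ve; apply: H => // e' lt'; apply: IH => //.
exact: ltn_trans lt' lt.
Qed.

Section Binomial.
Variables (K : fieldType) (m p : nat).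
Notation t := (tvar K).

Lemma co_binomial e : (m < p)%N ->
  co (t ^+ m + t ^+ p) e != 0 -> e = m \/ e = p.
Proof.
move=> mp; rewrite coD !co_tvarX.
case: (e =P m) => [->|_]; first by left.
case: (e =P p) => [->|_]; first by right.
by rewrite addr0 eqxx.
Qed.

Lemma near_binomial delta : (m + delta <= p)%N ->
  tord_ge (m + delta) (t ^+ m + t ^+ p - t ^+ m).
Proof.
move=> le; rewrite addrC addKr.
exact: tord_geW le (@tord_ge_tvarX K p).
Qed.

End Binomial.

(** Suppose that the ring of [C] contains [X = t ^ l V ^ l] and
    [Y = t ^ m V ^ m] for a unit [V]. The gap [p] of the semigroup occurs in
    [Y], since [Y] contains [y = t ^ m + t ^ p] and, by Lemma [no_xz], nothing
    that could cancel [t ^ p]. But neither [X] up to order [l + (p - m)] nor [Y]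
    below order [p] has gap terms. If [m] is not 0 in [K], the exponents of [V]
    below [p - m] are therefore degrees of derivations of the monomial curve, and
    [t ^ m V ^ m] cannot reach [t ^ p]. *)
Section NonMonomial.
Variables (K : fieldType) (a b : nat).
Hypotheses (a_ge2 : (2 <= a)%N) (b_ge2 : (2 <= b)%N).
Notation l := (b + 2)%N.
Notation m := (2 * a + 1)%N.
Notation n := (a * b + b + 1)%N.
Notation d1 := ((a + 1) * (b + 2))%N.
Notation Gamma k := (numerical_semigroup l m n k%N).
Hypothesis lm_coprime : gcdn l m = 1%N.
Variables (p q : nat).
Hypotheses (mp : (m < p)%N) (nq : (n < q)%N).
Hypothesis pE : (p + 2 * l = b * m)%N.
(* This is the bound [d1 + q - n >= gamma + l], as [gamma = p + l + 1]. *)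
Hypothesis q_ge : (p + 2 * l + 1 <= m + q)%N.
Hypothesis l_neq0 : l%:R != 0 :> K.
Notation t := (tvar K).
Notation y := (t ^+ m + t ^+ p).
Notation z := (t ^+ n + t ^+ q).
Notation C := (curve l y z).
Notation W := (wt (w3 l m n)).
Notation mon := (subst_mon C).
Notation ev := (fps_subst C).
Notation delta := (minn (p - m) (q - n)).
Notation gamma := (p + l + 1)%N.

Let l_gt0 : (0 < l)%N. Proof. by lia. Qed.
Let m_gt0 : (0 < m)%N. Proof. by lia. Qed.
Let n_gt0 : (0 < n)%N. Proof. by lia. Qed.
Let delta_gt0 : (0 < delta)%N. Proof. by lia. Qed.
Let yE : tord_ge (m + delta) (y - t ^+ m).
Proof. by apply: near_binomial; lia. Qed.
Let zE : tord_ge (n + delta) (z - t ^+ n).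
Proof. by apply: near_binomial; lia. Qed.

Lemma wt_unique k k' : W k = W k' -> (W k < d1)%N -> k = k'.
Proof.
rewrite !wt_w3 => e lt; rewrite (mon3_eta k) (mon3_eta k').
by have [-> -> ->] := rep_unique a_ge2 b_ge2 lm_coprime e lt.
Qed.

Lemma co_mon_supp k e : co (mon k) e != 0 ->
  exists j h, [/\ (j <= k iy)%N, (h <= k iz)%N &
    e = (W k + j * (p - m) + h * (q - n))%N].
Proof.
rewrite {1}(mon3_eta k) mon_mon3 => /coM_neq0 [e1 [e2 [-> ]]].
move=> /coM_neq0 [e3 [e4 [-> ]]]; rewrite co_tvarX.
case: (e3 =P _) => [->|_]; last by rewrite eqxx.
move=> _ yk zk.
have [|j lej ->] := co_powD (ltnW mp) _ yk.
  by move=> e0; apply: co_binomial.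
have [|h leh ->] := co_powD (ltnW nq) _ zk.
  by move=> e0; apply: co_binomial.
by exists j, h; split=> //; rewrite wt_w3 mulnC; lia.
Qed.

Lemma gap_pl : ~ Gamma (p + l).
Proof.
have -> : (p + l = b * m - l)%N by lia.
exact: frobenius_notin.
Qed.

Lemma gap_p : ~ Gamma p.
Proof.
move=> pG; apply: gap_pl; apply: semigroupD pG _.
by exists 1%N, 0%N, 0%N; lia.
Qed.

Variable V : fps 1 K.
Hypothesis V0 : co V 0 != 0.
Variables f g : fps 3 K.
Hypotheses (XE : ev f = t ^+ l * V ^+ l) (YE : ev g = t ^+ m * V ^+ m).

Notation f' := (drop_low l m n l f).
Notation g' := (drop_low l m n m g).

Let ge_l : tord_ge l (ev f).
Proof.
have V1 : tord_ge 0 (V ^+ l) by [].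
by have := tord_geM (@tord_ge_tvarX K l) V1; rewrite addn0 XE.
Qed.

Let ge_m : tord_ge m (ev g).
Proof.
have V1 : tord_ge 0 (V ^+ m) by [].
by have := tord_geM (@tord_ge_tvarX K m) V1; rewrite addn0 YE.
Qed.

Let gamma_le : (gamma <= d1 + delta)%N.
Proof. have := rel_yz a b; have := rel_zz a b; nia. Qed.

Lemma co_X e : (e < gamma)%N -> co (ev f) e = co (ev f') e.
Proof.
apply: (ev_drop_low l_gt0 m_gt0 n_gt0 delta_gt0 yE zE wt_unique gamma_le ge_l).
by lia.
Qed.

Lemma co_Y e : (e < gamma)%N -> co (ev g) e = co (ev g') e.
Proof.
apply: (ev_drop_low l_gt0 m_gt0 n_gt0 delta_gt0 yE zE wt_unique gamma_le ge_m).
by lia.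
Qed.

Lemma drop_low_wt w0 (h : fps 3 K) k :
  drop_low l m n w0 h k != 0 -> (w0 <= W k)%N.
Proof. by rewrite /=; case: ifP => //; rewrite eqxx. Qed.

(** The deformation of [y] only contributes to [X] beyond the order
    [l + (p - m)], and that of [z] even later. *)
Lemma X_gap d : (d <= p - m)%N -> ~ Gamma (d + l) -> co (ev f) (l + d) = 0.
Proof.
move=> led nG; rewrite co_X; last by lia.
apply: contrapT => /eqP /(co_ev_supp l_gt0 m_gt0 n_gt0 yE zE).
move=> [k [/drop_low_wt kW /co_mon_supp [j [h [lej leh e]]]]].
have Wk := wt_w3 l m n k.
case: j lej e => [|j] lej e.
  case: h leh e => [|h] leh e.
    case: nG; have -> : (d + l = W k)%N by lia.
    exact: semigroup_wt.
  have : (n <= k iz * n)%N by rewrite leq_pmull //; lia.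
  by have := leq_pmull (q - n) (ltn0Sn h); lia.
have Wl : W k = l.
  have := leq_pmull (p - m) (ltn0Sn j).
  by move: (h * (q - n))%N (j.+1 * (p - m))%N e => T T' e; lia.
have kl : (k ix * l + k iy * m + k iz * n = 1 * l + 0 * m + 0 * n)%N by lia.
have [|_ ky _] := rep_unique a_ge2 b_ge2 lm_coprime kl; last by lia.
by rewrite -Wk Wl ltn_Pmull //; lia.
Qed.

Lemma X_power d : co (ev f) (l + d) = co (V ^+ l) d.
Proof. by rewrite XE co_tshift. Qed.

Lemma Y_power d : co (ev g) (m + d) = co (V ^+ m) d.
Proof. by rewrite YE co_tshift. Qed.

(** Where [D] covers the exponents of [V] before [d], a term of degree [d] of
    [V] outside [D] would show up in [X] with factor [l]. *)
Lemma V_gap (D : nat -> Prop) d : D 0%N ->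
  (forall d e, D d -> D e -> D (d + e)%N) -> supp_below D d V -> ~ D d ->
  (d <= p - m)%N -> ~ Gamma (d + l) -> co V d = 0.
Proof.
move=> D0 DD VD nD led nG.
have := X_power d; rewrite (X_gap led nG) [X in V ^+ X]addn2.
rewrite (coX_outside D0 DD _ VD nD) => /esym/eqP.
rewrite !mulf_eq0 expf_eq0 (negbTE V0) andbF orbF.
by rewrite -addn2 (negbTE l_neq0) => /eqP.
Qed.

(** Up to order [p], gap terms of [Y] come from [y] itself or from [x ^ i z]. *)
Lemma Y_terms k e : g' k != 0 -> co (mon k) e != 0 -> (e <= p)%N ->
  [\/ e = W k, e = p /\ k = mon3 0 1 0 |
      exists2 i, k = mon3 i 0 1 & e = (i * l + q)%N].
Proof.
move=> /drop_low_wt kW /co_mon_supp [j [h [lej leh e_eq]]] lep.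
have Wk := wt_w3 l m n k; rewrite {2 3}(mon3_eta k).
move: (k ix) (k iy) (k iz) lej leh Wk => kx ky kz lej leh Wk.
case: j lej e_eq => [|j] lej e_eq.
  case: h leh e_eq => [|h] leh e_eq; first by apply: Or31; lia.
  have kz1 : kz = 1%N.
    have : (kz <= 1)%N; last by lia.
    rewrite leqNgt; apply/negP => kz2.
    have zn : (2 * n <= kz * n)%N by rewrite leq_mul2r kz2 orbT.
    have := leq_pmull (q - n) (ltn0Sn h).
    move: (kx * l)%N (ky * m)%N (kz * n)%N (h.+1 * (q - n))%N e_eq zn Wk.
    by move=> X Y Z T *; lia.
  have h0 : h = 0%N by lia.
  have ky0 : ky = 0%N.
    case: ky {lej} Wk => // ky Wk; exfalso; subst kz h.
    have := leq_pmull m (ltn0Sn ky).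
    by move: (kx * l)%N (ky.+1 * m)%N e_eq Wk => X Y *; lia.
  apply: Or33; exists kx; first by rewrite ky0 kz1.
  by subst kz h ky; lia.
have eW : W k = m /\ e = p.
  have := leq_pmull (p - m) (ltn0Sn j).
  by move: (h * (q - n))%N (j.+1 * (p - m))%N e_eq => X Y *; lia.
case: eW => Wm ep; apply: Or32; split=> //.
have ky1 : ky = 1%N by nia.
by subst ky; congr mon3; nia.
Qed.

(** Differences [w - l] with [w > l] in the semigroup belong to the monoid
    generated by [l], [m - l], [n - l]. *)
Lemma V_supp : (l < m)%N ->
  supp_below (numerical_semigroup l (m - l) (n - l)) (p - m) V.
Proof.
move=> lm; have ln : (l < n)%N by nia.
set P := numerical_semigroup _ _ _.
have P0 : P 0%N by exists 0%N, 0%N, 0%N.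
apply: closed_support => d lt VP nP.
apply: (V_gap P0 _ VP nP (ltnW lt)) => [d' e'|[i [j [h e]]]].
  exact: semigroupD.
apply: nP; case: i e => [|i] e.
  case: j e => [|j] e.
    case: h e => [|h] e; first by lia.
    by exists h, 0%N, h.+1; nia.
  by exists (j + h)%N, j.+1, h; nia.
by exists (i + j + h)%N, j, h; nia.
Qed.

(** If [x ^ i z] deforms within order [p], it cannot occur in [Y], since its
    leading term does not occur in [t ^ m V ^ m]. *)
Lemma no_xz i : (i * l + q <= p)%N -> g' (mon3 i 0 1) = 0.
Proof.
elim/ltn_ind: i => i IH le.
(* From [q_ge] and [i l + q <= p]. *)
have large : ((i + 2) * l < m)%N by nia.
have lm : (l < m)%N by nia.
have mn : (m < n)%N by nia.
have il : (n + i * l < p)%N by lia.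
have lt : (n + i * l < gamma)%N by lia.
have Y0 : co (ev g) (n + i * l) = 0.
  have -> : (n + i * l = m + (n + i * l - m))%N by lia.
  rewrite Y_power; apply: contrapT => /eqP VY.
  apply: (xz_over_y_notin a_ge2 b_ge2 lm_coprime large).
  have P0 : numerical_semigroup l (m - l) (n - l) 0 by exists 0%N, 0%N, 0%N.
  apply: (supp_belowX P0 (@semigroupD _ _ _) (V_supp lm) _ VY); lia.
move: Y0; rewrite co_Y // (co_ev l_gt0 m_gt0 n_gt0 yE zE _ (ltnSn _)).
have kd : (mdeg (mon3 i 0 1) < (n + i * l).+1)%N.
  rewrite ltnS (leq_trans (mdeg_le_wt _ (w3_gt0 l_gt0 m_gt0 n_gt0))) //.
  by rewrite wt_mon3; lia.
have lead1 : co (mon (mon3 i 0 1)) (n + i * l) = 1.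
  have -> : (n + i * l = W (mon3 i 0 1))%N by rewrite wt_mon3; lia.
  exact: co_mon_lead delta_gt0 yE zE _.
rewrite (bigD1 (BMultinom kd)) // big1; first by rewrite /= addr0 lead1 mulr1.
move=> k /eqP ne; have [->|gk] := eqVneq (g' k) 0; first by rewrite mul0r.
have [->|mk] := eqVneq (co (mon k) (n + i * l)) 0; first by rewrite mulr0.
case: ne; apply: val_inj => /=.
have [e|[e _]|[i' ki e]] := Y_terms gk mk (ltnW il).
- by apply: wt_unique; rewrite ?wt_mon3 -e //; [lia|nia].
- by lia.
case/eqP: gk; rewrite ki; apply: IH; last by lia.
by rewrite -(ltn_pmul2r l_gt0); lia.
Qed.

Lemma Y_gap e : (e < p)%N -> ~ Gamma e -> co (ev g) e = 0.
Proof.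
move=> lt nG; rewrite co_Y; last by lia.
apply: contrapT => /eqP /(co_ev_supp l_gt0 m_gt0 n_gt0 yE zE) [k [gk mk]].
have [ek|[ep _]|[i ki ei]] := Y_terms gk mk (ltnW lt).
- by apply: nG; rewrite ek; apply: semigroup_wt.
- by lia.
by case/eqP: gk; rewrite ki; apply: no_xz; lia.
Qed.

Lemma Y_p : co (ev g) p != 0.
Proof.
have only e : (e <= p)%N -> e = m \/ e = p ->
    co (ev g) e = g' (mon3 0 1 0) * co (mon (mon3 0 1 0)) e.
  move=> le em; rewrite co_Y; last by lia.
  rewrite (co_ev l_gt0 m_gt0 n_gt0 yE zE _ (ltnSn _)).
  have kd : (mdeg (mon3 0 1 0) < e.+1)%N.
    rewrite ltnS (leq_trans (mdeg_le_wt _ (w3_gt0 l_gt0 m_gt0 n_gt0))) //.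
    by rewrite wt_mon3; lia.
  rewrite (bigD1 (BMultinom kd)) // big1; first by rewrite /= addr0.
  move=> k /eqP ne.
  have [->|gk] := eqVneq (g' k) 0; first by rewrite mul0r.
  have [->|mk] := eqVneq (co (mon k) e) 0; first by rewrite mulr0.
  have [ek|[_ k010]|[i ki ei]] := Y_terms gk mk le.
  - case: em => em.
      case: ne; apply/val_inj/wt_unique; rewrite /= ?wt_mon3 -ek em //.
        by lia.
      by nia.
    by case: gap_p; rewrite -em ek; apply: semigroup_wt.
  - by case: ne; apply: val_inj.
  by case/eqP: gk; rewrite ki; apply: no_xz; rewrite -ei.
have g0 : g' (mon3 0 1 0) != 0.
  have : co (ev g) (m + 0) != 0 by rewrite Y_power coX0 expf_neq0.
  rewrite addn0 only; [|exact: ltnW|by left].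
  by apply: contraNneq => ->; rewrite mul0r.
rewrite only //; last by right.
rewrite mon_mon3 muln0 !expr0 mul1r mulr1 expr1 coD !co_tvarX eqxx.
by rewrite gtn_eqF // add0r mulr1.
Qed.

Lemma not_monomial : False.
Proof.
have Vp : co (V ^+ m) (p - m) != 0.
  by rewrite -Y_power subnKC ?Y_p // ltnW.
have nGp : ~ Gamma (p - m + l).
  move=> G; apply: gap_pl.
  have -> : (p + l = p - m + l + m)%N by lia.
  by apply: semigroupD G _; exists 0%N, 1%N, 0%N; lia.
(* If [m = 0] in [K], then [V ^ m] has derivative 0, whereas
   [p - m = (b - 1) m - 2 l = - 2 l] is not 0, as [m] is odd. *)
have [m0|m_neq0] := eqVneq (m%:R : K) 0.
  have m0' : (2 * a).+1%:R = 0 :> K by rewrite -addn1.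
  have Vp' := Vp; rewrite [X in V ^+ X]addn1 in Vp'.
  have /eqP := coX_char V (p - m) m0'.
  rewrite mulf_eq0 (negbTE Vp') orbF => /eqP pm0.
  have : (b * m)%:R = 0 :> K by rewrite natrM m0 mulr0.
  have -> : (b * m = (p - m) + m + 2 * l)%N by lia.
  rewrite (natrD _ (p - m + m)) (natrD _ (p - m)) pm0 m0 !add0r natrM => /eqP.
  rewrite mulf_eq0 (negbTE l_neq0) orbF => /eqP two0.
  by move/eqP: m0; rewrite natrD natrM two0 mul0r add0r oner_eq0.
pose D := shift a b.
have D0 : D 0%N := shift0 a b.
have DD d e : D d -> D e -> D (d + e)%N by apply: shiftD.
have VD : supp_below D (p - m) V.
  apply: closed_support => d lt VD nD.
  have [Gl|nGl] := pselect (Gamma (d + l)); last first.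
    exact: (V_gap D0 DD VD nD (ltnW lt) nGl).
  have nGm : ~ Gamma (m + d) by rewrite (addnC m) => Gm; apply: nD.
  have := Y_power d; rewrite Y_gap //; last by lia.
  rewrite [X in V ^+ X]addn1 (coX_outside D0 DD _ VD nD) => /esym/eqP.
  rewrite !mulf_eq0 expf_eq0 (negbTE V0) andbF orbF.
  by rewrite -addn1 (negbTE m_neq0) => /eqP.
have nD : ~ D (p - m)%N by case.
case/eqP: Vp; rewrite [X in V ^+ X]addn1 (coX_outside D0 DD _ VD nD).
by rewrite (V_gap D0 DD VD nD) // mulr0.
Qed.

End NonMonomial.

(** * The deformed monomial curves *)

Section Deformation.
Variables (R : realType) (K : fieldType) (v : K -> R).
Hypothesis v_abs : absolute_value v.
Variables (a b : nat).
Hypotheses (a_ge2 : (2 <= a)%N) (b_ge2 : (2 <= b)%N).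
Notation l := (b + 2)%N.
Notation m := (2 * a + 1)%N.
Notation n := (a * b + b + 1)%N.
Notation d1 := ((a + 1) * (b + 2))%N.
Hypothesis lm_coprime : gcdn l m = 1%N.
Variables (p q gamma : nat).
Hypotheses (mp : (m < p)%N) (nq : (n < q)%N).
Hypothesis gammaP : is_conductor (numerical_semigroup l m n) gamma.
Notation delta := (minn (p - m) (q - n)).
Notation t := (tvar K).
Notation C := (deformed_curve K l m n p q).

Let l_gt0 : (0 < l)%N. Proof. by lia. Qed.
Let m_gt0 : (0 < m)%N. Proof. by lia. Qed.
Let n_gt0 : (0 < n)%N. Proof. by lia. Qed.
Let delta_gt0 : (0 < delta)%N. Proof. by lia. Qed.
Let yE : tord_ge (m + delta) (t ^+ m + t ^+ p - t ^+ m).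
Proof. by apply: near_binomial; lia. Qed.
Let zE : tord_ge (n + delta) (t ^+ n + t ^+ q - t ^+ n).
Proof. by apply: near_binomial; lia. Qed.

Lemma deformed_value_semigroup : (gamma <= d1 + delta)%N ->
  value_semigroup (analytic_subalgebra v C) = numerical_semigroup l m n.
Proof.
move=> gamma_le; have [above _] := gammaP.
have ordP (h : fps 1 K) d : fps_ord h d <-> co h d != 0 /\ tord_ge d h.
  split=> [[[k kd hk] low]|[hd low]].
    split; first by rewrite /co -kd -tdegE.
    by move=> e lt; apply: low; rewrite mdeg_tdeg.
  split; first by exists (tdeg d); rewrite ?mdeg_tdeg.
  by move=> k kd; rewrite (tdegE k); apply: low.
apply/seteqP; split=> d /=.
  move=> [_ [f fc <-]] /ordP [fd low].
  case: (ltnP d gamma) => [lt|]; last exact: above.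
  exact: (value_in_semigroup l_gt0 m_gt0 n_gt0 delta_gt0 yE zE
    (wt_unique a_ge2 b_ge2 lm_coprime) gamma_le low fd lt).
move=> [i [j [h ->]]]; rewrite -wt_mon3.
exists (subst_mon C (mon3 i j h)).
  by apply: analytic_mon => //; apply: (curve0 l_gt0 m_gt0 n_gt0 yE zE).
apply/ordP; split.
  by rewrite (co_mon_lead l delta_gt0 yE zE) oner_eq0.
by move=> e; apply: (co_mon_low yE zE).
Qed.

Lemma convergent_binomial i j : convergent v (t ^+ i + t ^+ j).
Proof. by apply: convergentD => //; apply: convergent_tvarX. Qed.

Lemma deformed_ci : (gamma + l <= d1 + delta)%N ->
  set_theoretic_ci_space_curve v C.
Proof.
have [above _] := gammaP; move=> gamma_le.
exact: (near_monomial_ci v_abs a_ge2 b_ge2 lm_coprime delta_gt0 yE zE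
  (convergent_binomial _ _) (convergent_binomial _ _) above gamma_le).
Qed.

Lemma deformed_not_monomial : (p + l + 1)%N = gamma ->
  (gamma + l <= d1 + q - n)%N -> l%:R != 0 :> K ->
  ~ isomorphic_subalgebras (analytic_subalgebra v C)
      (analytic_subalgebra v (monomial_curve K l m n)).
Proof.
move=> pE q_ge l_neq0 iso; have ryz := rel_yz a b.
have conductor := conductorE a_ge2 b_ge2 lm_coprime gammaP.
have mn : (m < n)%N.
  by have : (a * 2 <= a * b)%N; [rewrite leq_mul2l b_ge2 orbT|lia].
have [|V [V0 [f _ XE] [g _ YE]]] :=
    isomorphic_monomial v_abs l_gt0 m_gt0 mn delta_gt0 yE zE _ iso.
  by rewrite /coprime gcdnC lm_coprime.
by apply: (not_monomial a_ge2 b_ge2 lm_coprime mp nq _ _ l_neq0 V0 XE YE); lia.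
Qed.

End Deformation.

Theorem corollary1p1 (R : realType) (K : closedFieldType) (v : K -> R)
  (v_abs : absolute_value v) (v_nontriv : nontrivial_absolute_value v)
  (v_complete : complete_absolute_value v)
  (a b : nat) (a_ge2 : (2 <= a)%N) (b_ge2 : (2 <= b)%N) :
  let l := (b + 2)%N in
  let m := (2 * a + 1)%N in
  let n := (a * b + b + 1)%N in
  gcdn l m = 1%N ->
  forall p q : nat, (m < p)%N -> (n < q)%N ->
  forall gamma : nat, is_conductor (numerical_semigroup l m n) gamma ->
  let d1 := ((a + 1) * (b + 2))%N in
  let delta := minn (p - m) (q - n) in
  [/\ (* (a) *)
      (gamma <= d1 + delta)%N ->
        value_semigroup (analytic_subalgebra v (deformed_curve K l m n p q)) =
        numerical_semigroup l m n,
      (* (b) *)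
      (gamma + l <= d1 + delta)%N ->
        set_theoretic_ci_space_curve v (deformed_curve K l m n p q) &
      (* (c) *)
      (3 <= a)%N -> (3 <= b)%N -> (gamma + l <= d1 + q - n)%N ->
        (m < gamma - 1 - l)%N /\
        let C := deformed_curve K l m n (gamma - 1 - l) q in
        (* in characteristic dividing l this clause fails *)
        (l%:R != 0 :> K ->
          ~ isomorphic_subalgebras (analytic_subalgebra v C)
              (analytic_subalgebra v (monomial_curve K l m n))) /\
        set_theoretic_ci_space_curve v C].
Proof.
move=> l m n lm_coprime p q mp nq gamma gammaP d1 delta; split.
- exact: deformed_value_semigroup.
- exact: deformed_ci.
move=> a_ge3 b_ge3 q_ge.
have ge33 : (3 * b <= a * b)%N /\ (a * 3 <= a * b)%N.
  by rewrite leq_mul2r leq_mul2l a_ge3 b_ge3 !orbT.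
have gammaE := conductorE a_ge2 b_ge2 lm_coprime gammaP.
have mp' : (m < gamma - 1 - l)%N by rewrite /m /l; lia.
split=> //; split.
  apply: (deformed_not_monomial v_abs _ _ lm_coprime mp' nq gammaP) => //.
  by rewrite /l /m in mp' *; lia.
apply: (deformed_ci v_abs a_ge2 b_ge2 lm_coprime mp' nq gammaP).
by rewrite /l /m /n /d1 in q_ge mp' *; lia.
Qed.
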